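(* If $\{\mathcal{S}_n\}_{n=1}^\infty$ is an inductive system of $(\min,\mathrm{el})$-nuclear operator systems, then $\varinjlim\mathcal{S}_n$ is also $(\min,\mathrm{el})$-nuclear.
   Context: An operator system is a unital self-adjoint subspace of $B(H)$. Inductive systems of operator systems have unital complete order embeddings $u_n:\mathcal{S}_n\to\mathcal{S}_{n+1}$ as connecting maps; the inductive limit $\varinjlim\mathcal{S}_n$ is the operator system $\mathcal{S}$ with unital complete order embeddings $\lambda_n:\mathcal{S}_n\to\mathcal{S}$ satisfying $\lambda_n=\lambda_{n+1}\circ u_n$ and $\mathcal{S}=\overline{\bigcup_n\lambda_n(\mathcal{S}_n)}$, universal for compatible families of unital completely positive maps. For operator systems $\mathcal{S},\mathcal{T}$, the tensor products are operator system structures on the algebraic tensor product. $\min$: $u\in M_n(\mathcal{S}\otimes_{\min}\mathcal{T})^+$ iff $(\varphi\otimes\psi)^{(n)}(u)\ge 0$ for all unital completely positive maps $\varphi:\mathcal{S}\to M_k$, $\psi:\mathcal{T}\to M_m$, $k,m\in\mathbb{N}$. $\max$: the positive cones are the Archimedeanizations $\{u\in M_n(\mathcal{S}\otimes\mathcal{T}): u+\varepsilon 1\in D_n\ \forall\varepsilon>0\}$ of $D_n=\{\alpha(P\otimes Q)\alpha^*:P\in M_k(\mathcal{S})^+,Q\in M_m(\mathcal{T})^+,\alpha\in M_{n,km}(\mathbb{C}),k,m\in\mathbb{N}\}$. $\mathrm{el}$: the structure on $\mathcal{S}\otimes\mathcal{T}$ inherited from the inclusion $\mathcal{S}\otimes_{\mathrm{el}}\mathcal{T}\subset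 I(\mathcal{S})\otimes_{\max}\mathcal{T}$, where $I(\mathcal{S})$ is the injective envelope of $\mathcal{S}$. For operator system tensor products $\alpha,\beta$, $\mathcal{S}$ is $(\alpha,\beta)$-nuclear if the identity map $\mathcal{S}\otimes_\alpha\mathcal{T}\to\mathcal{S}\otimes_\beta\mathcal{T}$ is a complete order isomorphism for every operator system $\mathcal{T}$. *)

(* Defs.v *)
From HB Require Import structures.
From mathcomp Require Import all_boot all_order all_algebra.
From mathcomp Require Import sesquilinear.
From mathcomp Require Import complex mxtens.
From mathcomp Require Import all_classical all_reals all_analysis.

Set Implicit Arguments.
Unset Strict Implicit.
Unset Printing Implicit Defensive.

Import Order.TTheory GRing.Theory Num.Theory.
Import numFieldNormedType.Exports.

Local Open Scope classical_set_scope.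
Local Open Scope ring_scope.

Section TensorProduct.
Variable K : fieldType.

(* Bilinear forms separate the points of the algebraic tensor product of two
   vector spaces, so it can be taken to be the span of the evaluations
   [v (x) w : b |-> b v w] inside the functionals on the bilinear forms; see
   [tens_universal] for its universal property. *)
Definition bilform (V W : lmodType K) := {bilinear V -> W -> K | *%R & *%R}.

Definition tens_eval (V W : lmodType K) (v : V) (w : W) : bilform V W -> K^o :=
  fun b => b v w.

Definition tens_span (V W : lmodType K) : {pred (bilform V W -> K^o)} :=
  fun f => `[< exists s : seq (V * W), f = \sum_(p <- s) tens_eval p.1 p.2 >].

Lemma tens_evalZl (V W : lmodType K) (a : K) (v : V) (w : W) :
  tens_eval (a *: v) w = a *: tens_eval v w.
Proof. by apply/funext => b; rewrite /tens_eval linearZl_LR. Qed.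

Fact tens_span_submod (V W : lmodType K) :
  GRing.submod_closed (@tens_span V W).
Proof.
split=> [|a f g /asboolP[s ->] /asboolP[t ->]]; apply/asboolP.
  by exists [::]; rewrite big_nil.
exists ([seq (a *: p.1, p.2) | p <- s] ++ t).
rewrite big_cat big_map scaler_sumr; congr (_ + _).
by apply: eq_bigr => p _; rewrite tens_evalZl.
Qed.

HB.instance Definition _ (V W : lmodType K) :=
  GRing.isSubmodClosed.Build K (bilform V W -> K^o) (@tens_span V W)
    (tens_span_submod V W).

Record tensor (V W : lmodType K) := Tensor {
  tens_val :> bilform V W -> K^o ;
  tens_valP : tens_val \in @tens_span V W }.

HB.instance Definition _ (V W : lmodType K) := [isSub for @tens_val V W].
HB.instance Definition _ (V W : lmodType K) := [Choice of tensor V W by <:].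
HB.instance Definition _ (V W : lmodType K) :=
  [SubChoice_isSubLmodule of tensor V W by <:].

Section TensorTheory.
Variables V W : lmodType K.

Fact tens_subproof (v : V) (w : W) : tens_eval v w \in @tens_span V W.
Proof. by apply/asboolP; exists [:: (v, w)]; rewrite big_seq1. Qed.

Definition tens (v : V) (w : W) : tensor V W := Tensor (tens_subproof v w).

Lemma tensP (u : tensor V W) :
  exists s : seq (V * W), u = \sum_(p <- s) tens p.1 p.2.
Proof.
have [s us] := asboolP _ (tens_valP u); exists s.
by apply: val_inj; rewrite raddf_sum [LHS]us.
Qed.

Fact tens_bilinear : bilinear_for *:%R *:%R tens.
Proof.
split=> [w a v v'|v a w w']; apply: val_inj; apply/funext => b /=.
  by rewrite /tens_eval linearPl.
by rewrite /tens_eval linearPr.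
Qed.

HB.instance Definition _ :=
  bilinear_isBilinear.Build K V W (tensor V W) *:%R *:%R tens tens_bilinear.

End TensorTheory.

(* Nonzero vectors are separated by linear functionals. *)
Lemma linear_sep (Z : lmodType K) (z : Z) :
  (forall f : {linear Z -> K^o}, f z = 0) -> z = 0.
Proof.
move=> z0; apply: contrapT => zN0.
pose P (M : set Z) := (forall a x y, M x -> M y -> M (a *: x + y)) /\ ~ M z.
have [|M [[MD Mz] Mmax]] := @Zorn_bigcup _ P.
  move=> F FP Ftot; split=> [a x y [A FA Ax] [B FB By]|[A FA Az]].
    have [AB|BA] := Ftot A B FA FB.
      by exists B => //; apply: (FP _ FB).1 => //; exact: AB.
    by exists A => //; apply: (FP _ FA).1 => //; exact: BA.
  by have [_] := FP _ FA; apply.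
have M0 : M 0.
  apply: contrapT => M0; apply: (Mmax (M `|` [set 0])).
    split=> [x Mx|sub]; first by left.
    by apply: M0; apply: sub; right.
  split=> [a x y|[|/=]]; [|exact: Mz|by []].
  case=> [Mx|/= ->]; last by rewrite scaler0 add0r.
  case=> [My|/= ->]; left; first exact: MD.
  suff M0' : M 0 by rewrite addr0 -[a *: x]addr0; exact: MD.
  by have := MD (-1) _ _ Mx Mx; rewrite scaleN1r addNr.
have MB x y : M x -> M y -> M (x - y).
  by move=> Mx My; rewrite addrC -scaleN1r; exact: MD.
have MZ a x : M x -> M (a *: x) by move=> Mx; rewrite -[_ *: _]addr0; exact: MD.
have Mz_ex x : exists c, M (x - c *: z).
  have [Mx|Mx] := pselect (M x); first by exists 0; rewrite scale0r subr0.
  pose N := [set y | exists2 m, M m & exists c, y = m + c *: x].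
  have [[m Mm [c zE]]|Nz] := pselect (N z).
    have c0 : c != 0.
      by apply: contra_notN Mz => /eqP c0; rewrite zE c0 scale0r addr0.
    exists c^-1; have -> : x - c^-1 *: z = - c^-1 *: m.
      by rewrite zE scalerDr scalerA mulVf// scale1r opprD addrCA subrr addr0 scaleNr.
    exact: MZ.
  exfalso; apply: (Mmax N).
    split=> [y My|sub]; first by exists y => //; exists 0; rewrite scale0r addr0.
    by apply: Mx; apply: sub; exists 0 => //; exists 1; rewrite scale1r add0r.
  split=> // a y y' [m Mm [c ->]] [m' Mm' [c' ->]].
  exists (a *: m + m'); first exact: MD.
  by exists (a * c + c'); rewrite scalerDr scalerDl scalerA addrACA.
have Mz_uniq a : M (a *: z) -> a = 0.
  move=> Maz; apply/eqP; apply: contra_notT Mz => a0.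
  by rewrite -[z]scale1r -(mulVf a0) -scalerA; exact: MZ.
pose f x : K^o := sval (cid (Mz_ex x)).
have fP x : M (x - f x *: z) by rewrite /f; case: cid.
have f_uniq x c : M (x - c *: z) -> f x = c.
  move=> Mxc; apply/eqP; rewrite -subr_eq0; apply/eqP; apply: Mz_uniq.
  have := MB _ _ Mxc (fP x).
  by rewrite opprB addrC addrA subrK -scalerBl.
have f_lin : linear f.
  move=> a x y; apply: f_uniq; rewrite scalerDl -scalerA opprD addrACA -scalerBr.
  exact: MD.
pose L := GRing.isLinear.Build _ _ _ _ f f_lin.
pose g : {linear Z -> K^o} := HB.pack f L.
have /= gz := z0 g.
have : f z = 1 by apply: f_uniq; rewrite scale1r subrr.
by rewrite gz => /esym/eqP; rewrite oner_eq0.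
Qed.

Lemma tens_universal (V W Z : lmodType K) (b : {bilinear V -> W -> Z}) :
  exists f : {linear tensor V W -> Z}, (forall v w, f (tens v w) = b v w) /\
    forall g : {linear tensor V W -> Z}, (forall v w, g (tens v w) = b v w) ->
      g =1 f.
Proof.
pose ev (s : seq (V * W)) := \sum_(p <- s) b p.1 p.2.
pose S (u : tensor V W) := sval (cid (tensP u)).
have SP u : u = \sum_(p <- S u) tens p.1 p.2 by rewrite /S; case: cid.
have ev0 s : \sum_(p <- s) tens p.1 p.2 = 0 -> ev s = 0.
  move=> s0; apply: linear_sep => f.
  have fb_lin : bilinear_for *%R *%R (fun v w => f (b v w) : K).
    split=> [w a v v'|v a w w'] /=; first by rewrite linearPl linearP.
    by rewrite linearPr linearP.
  pose fb : bilform V W := HB.pack (fun v w => f (b v w) : K)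
    (bilinear_isBilinear.Build K V W K *%R *%R _ fb_lin).
  have /(congr1 (fun g : bilform V W -> K^o => g fb)) := congr1 (@tens_val V W) s0.
  rewrite -[X in X fb]/(val _) raddf_sum /= fct_sumE /ev raddf_sum.
  by under eq_bigr do rewrite /tens_eval.
have neg_sum (Z' : lmodType K) (c : {bilinear V -> W -> Z'}) (s : seq (V * W)) :
    \sum_(p <- s) c (- p.1) p.2 = - \sum_(p <- s) c p.1 p.2.
  by rewrite -sumrN; apply: eq_bigr => p _; exact: linearNl.
have ev_uniq u s : u = \sum_(p <- s) tens p.1 p.2 -> ev (S u) = ev s.
  move=> us; apply/eqP; rewrite -subr_eq0; apply/eqP.
  have := ev0 (S u ++ [seq (- p.1, p.2) | p <- s]).
  rewrite /ev !big_cat !big_map /= -SP.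
  by rewrite !neg_sum -us subrr; apply.
have f_lin : linear (fun u => ev (S u)).
  move=> a u u'; rewrite (ev_uniq _ ([seq (a *: p.1, p.2) | p <- S u] ++ S u')).
    rewrite /ev big_cat big_map /= scaler_sumr; congr (_ + _).
    by apply: eq_bigr => p _; rewrite linearZl_LR.
  rewrite big_cat big_map /= -SP {1}[u]SP scaler_sumr; congr (_ + _).
  by apply: eq_bigr => p _; rewrite linearZl_LR.
pose f : {linear tensor V W -> Z} := HB.pack (fun u => ev (S u))
  (GRing.isLinear.Build _ _ _ _ (fun u => ev (S u)) f_lin).
have fE v w : f (tens v w) = b v w.
  by rewrite /= (ev_uniq _ [:: (v, w)]) /ev big_seq1.
exists f; split=> // g gE u; rewrite [u]SP (raddf_sum g) (raddf_sum f).
by apply: eq_bigr => p _; exact: etrans (gE _ _) (esym (fE _ _)).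
Qed.

Section TensorMap.
Variables (V V' W W' : lmodType K).
Variables (f : {linear V -> V'}) (g : {linear W -> W'}).

Definition bil_comp (b : bilform V' W') : V -> W -> K := fun v w => b (f v) (g w).

Fact bil_comp_bilinear (b : bilform V' W') : bilinear_for *%R *%R (bil_comp b).
Proof.
by split=> [w a v v'|v a w w']; rewrite /bil_comp /= linearP ?linearPl ?linearPr.
Qed.

HB.instance Definition _ (b : bilform V' W') :=
  bilinear_isBilinear.Build K V W K *%R *%R (bil_comp b) (bil_comp_bilinear b).

Fact tens_map_subproof (u : tensor V W) :
  (fun b => u (bil_comp b)) \in @tens_span V' W'.
Proof.
have [s us] := asboolP _ (tens_valP u); apply/asboolP.
exists [seq (f p.1, g p.2) | p <- s]; rewrite big_map us.
by apply/funext => b; rewrite !fct_sumE.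
Qed.

Definition tens_map (u : tensor V W) : tensor V' W' := Tensor (tens_map_subproof u).

Fact tens_map_linear : linear tens_map.
Proof. by move=> a u u'; apply: val_inj; apply/funext. Qed.

HB.instance Definition _ :=
  GRing.isLinear.Build K (tensor V W) (tensor V' W') *:%R tens_map tens_map_linear.

Lemma tens_mapE (v : V) (w : W) : tens_map (tens v w) = tens (f v) (g w).
Proof. exact: val_inj. Qed.

End TensorMap.

Section TensorMatrix.
Variables (V W : lmodType K) (k m : nat).
Variables (f : {linear V -> 'M[K]_k}) (g : {linear W -> 'M[K]_m}).

Definition bil_entry (i j : 'I_k * 'I_m) : V -> W -> K :=
  fun v w => f v i.1 j.1 * g w i.2 j.2.

Fact bil_entry_bilinear (i j : 'I_k * 'I_m) :
  bilinear_for *%R *%R (bil_entry i j).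
Proof.
split=> [w a v v'|v a w w']; rewrite /bil_entry /= linearP !mxE.
  by rewrite mulrDl mulrA.
by rewrite mulrDr mulrCA.
Qed.

HB.instance Definition _ (i j : 'I_k * 'I_m) :=
  bilinear_isBilinear.Build K V W K *%R *%R (bil_entry i j) (bil_entry_bilinear i j).

(* [f (x) g : V (x) W -> M_k (x) M_m = M_(k * m)]. *)
Definition tens_map_mx (u : tensor V W) : 'M[K]_(k * m) :=
  \matrix_(i, j) u (bil_entry (mxtens_unindex i) (mxtens_unindex j)).

Lemma tens_map_mxE (v : V) (w : W) : tens_map_mx (tens v w) = f v *t g w.
Proof. by apply/matrixP => i j; rewrite !mxE. Qed.

End TensorMatrix.

End TensorProduct.

Section Hilbert.
Variable R : realType.
Local Notation C := R[i].

(* The inner product is linear in its first argument and conjugate-linear in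
   the second. *)
Record hilbert := Hilbert {
  hilb_sort :> completeNormedModType C ;
  inner : {dot hilb_sort for (@Num.conj C)} ;
  inner_norm : forall x : hilb_sort, `|x| ^+ 2 = inner x x }.

Definition bounded_op (H : hilbert) : set (H -> H) :=
  [set a | linear a /\ continuous a].

Definition is_adjoint (H : hilbert) (a b : H -> H) : Prop :=
  forall x y : H, inner H (a x) y = inner H x (b y).

Definition norm_closure (H : hilbert) (A : set (H -> H)) : set (H -> H) :=
  [set a | bounded_op a /\ forall e : R, 0 < e ->
     exists2 b, A b & forall h : H, `|a h - b h| <= e%:C%C * `|h|].

End Hilbert.

Section OperatorSystem.
Variable R : realType.
Local Notation C := R[i].

Record opsys := OpSys {
  os_hilb : hilbert R ;
  os_set : set (os_hilb -> os_hilb) ;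
  os_bounded : os_set `<=` @bounded_op R os_hilb ;
  os_unit : os_set id ;
  os_linear : forall (c : C) a b, os_set a -> os_set b -> os_set (c *: a + b) ;
  os_adjoint : forall a, os_set a -> exists2 b, os_set b & is_adjoint a b }.

Arguments os_set : clear implicits.

Definition os_pred (S : opsys) : {pred (os_hilb S -> os_hilb S)} :=
  fun a => `[< os_set S a >].

Fact os_pred_submod (S : opsys) : GRing.submod_closed (@os_pred S).
Proof.
split=> [|c a b /asboolP Sa /asboolP Sb]; apply/asboolP; last exact: os_linear.
have := os_linear (-1) (os_unit S) (os_unit S).
by rewrite scaleN1r addNr.
Qed.

HB.instance Definition _ (S : opsys) :=
  GRing.isSubmodClosed.Build C (os_hilb S -> os_hilb S) (@os_pred S)
    (os_pred_submod S).

Record os_elt (S : opsys) := OsElt {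
  os_val :> os_hilb S -> os_hilb S ;
  os_valP : os_val \in @os_pred S }.

HB.instance Definition _ (S : opsys) := [isSub for @os_val S].
HB.instance Definition _ (S : opsys) := [Choice of os_elt S by <:].
HB.instance Definition _ (S : opsys) :=
  [SubChoice_isSubLmodule of os_elt S by <:].

Coercion os_lmod (S : opsys) : lmodType C := os_elt S.

Definition os_one (S : opsys) : S := OsElt (asboolT (os_unit S)).

(* A family of sets of matrices over [V], one for each matrix size, meant to
   consist of the positive elements of the [M_n(V)]. *)
Definition mcone (V : Type) := forall n : nat, set 'M[V]_n.

(* Positivity of a matrix of operators as an operator on [H^n]. *)
Definition os_cone (S : opsys) : mcone S := fun n => [set A |
  forall h : 'I_n -> os_hilb S,
    0 <= \sum_i \sum_j inner (os_hilb S) ((A i j : os_elt S) (h j)) (h i)].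

(* Positivity of an element of [M_n(M_k)] as an operator on [(C^k)^n]. *)
Definition mx_cone (k : nat) : mcone 'M[C]_k := fun n => [set A |
  forall h : 'I_n -> 'cV[C]_k,
    0 <= \sum_i \sum_j ((map_mx Num.conj (h i))^T *m A i j *m h j) 0 0].

Definition cp (V W : lmodType C) (P : mcone V) (Q : mcone W)
    (f : {linear V -> W}) : Prop :=
  forall n (A : 'M[V]_n), P n A -> Q n (map_mx f A).

Definition complete_order_iso (V W : lmodType C) (P : mcone V) (Q : mcone W)
    (f : {linear V -> W}) : Prop :=
  bijective f /\ forall n (A : 'M[V]_n), P n A <-> Q n (map_mx f A).

Definition ucp (S T : opsys) (f : {linear S -> T}) : Prop :=
  f (os_one S) = os_one T /\ cp (@os_cone S) (@os_cone T) f.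

Definition ucp_mx (S : opsys) (k : nat) (f : {linear S -> 'M[C]_k}) : Prop :=
  f (os_one S) = 1%:M /\ cp (@os_cone S) (@mx_cone k) f.

(* Unital complete order embeddings. *)
Definition ucoe (S T : opsys) (f : {linear S -> T}) : Prop :=
  [/\ f (os_one S) = os_one T, injective f &
      forall n (A : 'M[S]_n), os_cone A <-> os_cone (map_mx f A)].

Definition injective_os (I : opsys) : Prop :=
  forall (E F : opsys) (j : {linear E -> F}) (f : {linear E -> I}),
    ucoe j -> ucp f ->
    exists2 g : {linear F -> I}, ucp g & forall x, g (j x) = f x.

(* An injective operator system containing [S], with no proper injective
   operator subsystem that contains [S]. *)
Record injective_envelope (S : opsys) := InjectiveEnvelope {
  ie_os :> opsys ;
  ie_emb : {linear S -> ie_os} ;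
  ie_emb_ucoe : ucoe ie_emb ;
  ie_injective : injective_os ie_os ;
  ie_minimal : forall (J : opsys) (j : {linear J -> ie_os}),
    ucoe j -> injective_os J -> range ie_emb `<=` range j -> range j = setT }.

(* The universal property quantifies over the norm-closed operator systems [T]:
   as [L] is norm-closed, a compatible family on the [S n] need not extend to
   [L] inside a [T] that is not. *)
Definition inductive_limit (S : nat -> opsys) (u : forall n, {linear S n -> S n.+1})
    (L : opsys) (lam : forall n, {linear S n -> L}) : Prop :=
  [/\ forall n, ucoe (lam n),
      forall n x, lam n x = lam n.+1 (u n x),
      os_set L = norm_closure (\bigcup_n range (fun x : S n => os_val (lam n x))) &
      forall (T : opsys) (f : forall n, {linear S n -> T}),
        norm_closure (os_set T) `<=` os_set T ->
        (forall n, ucp (f n)) -> (forall n x, f n x = f n.+1 (u n x)) ->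
        exists g : {linear L -> T}, [/\ ucp g, forall n x, g (lam n x) = f n x &
          forall g' : {linear L -> T}, ucp g' ->
            (forall n x, g' (lam n x) = f n x) -> g' =1 g]].

Section Tensor.
Variables S T : opsys.

Definition min_cone : mcone (tensor S T) := fun n => [set u |
  forall k m (f : {linear S -> 'M[C]_k}) (g : {linear T -> 'M[C]_m}),
    ucp_mx f -> ucp_mx g -> mx_cone (map_mx (tens_map_mx f g) u)].

Definition tens_mx (k m : nat) (P : 'M[S]_k) (Q : 'M[T]_m) :
    'M[tensor S T]_(k * m) :=
  \matrix_(i, j) tens (P (mxtens_unindex i).1 (mxtens_unindex j).1)
                      (Q (mxtens_unindex i).2 (mxtens_unindex j).2).

(* [alpha X alpha^*]. *)
Definition conj_act (V : lmodType C) (n p : nat) (alpha : 'M[C]_(n, p))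
    (X : 'M[V]_p) : 'M[V]_n :=
  \matrix_(i, j) \sum_a \sum_b (alpha i a * (alpha j b)^*) *: X a b.

Definition max_precone : mcone (tensor S T) := fun n => [set u |
  exists k m (P : 'M[S]_k) (Q : 'M[T]_m) (alpha : 'M[C]_(n, k * m)),
    [/\ os_cone P, os_cone Q & u = conj_act alpha (tens_mx P Q)]].

Definition max_cone : mcone (tensor S T) := fun n => [set u |
  forall e : R, 0 < e -> max_precone
    (\matrix_(i, j) (u i j + (e%:C%C *+ (i == j)) *: tens (os_one S) (os_one T)))].

End Tensor.

Definition el_cone (S : opsys) (I : injective_envelope S) (T : opsys) :
    mcone (tensor S T) := fun n => [set u |
  max_cone (map_mx (tens_map (ie_emb I) (idfun : T -> T)) u)].

Definition nuclear (S : opsys) (alpha beta : forall T : opsys, mcone (tensor S T)) :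
    Prop :=
  forall T : opsys, complete_order_iso (@alpha T) (@beta T) idfun.

End OperatorSystem.

(* Main.v *)
From HB Require Import structures.
Require Import Defs.
From mathcomp Require Import all_boot all_order all_algebra.
From mathcomp Require Import sesquilinear spectral complex mxtens ring.
From mathcomp Require Import all_classical all_reals all_analysis.

(** Two inclusions of cones in [L (x) T] are to be proved.

    The elementary cone lies in the minimal one for every operator system
    ([el_cone_min]). Over the injective envelope, an element of the maximal cone
    is sent by [f (x) g] to limits of compressions of Kronecker products of
    positive matrices ([max_cone_min]), so it is minimal-positive; and the minimal
    cone of an operator subsystem is the restriction of that of the larger system
    ([min_cone_ucoe]). The last fact needs no extension theorem: compressions to
    finite-dimensional subspaces are unital completely positive, so
    minimal-positivity of [u] just says that every slice [(id (x) g) u] is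
    positive over the first factor ([min_coneP]), and complete order embeddings
    reflect this.

    Conversely, let [v] be minimal-positive in [L (x) T]. Unital completely
    positive maps separate the points of the algebraic tensor product, so [v] is
    self-adjoint in the strong sense that [v = sum_i X_i (x) y_i] with self-adjoint
    [X_i] and [y_i] ([min_cone_herm_sum]). By density of the [lam n (S n)], the
    [X_i] are close in norm to self-adjoint matrices [Y_i] over a single [S m]
    ([lam_approx_herm]). Set [w = sum_i Y_i (x) y_i]. A tensor of self-adjoint
    elements one of which is small is absorbed by a small multiple of the unit
    already in the maximal cone, because
    [2 (p (x) q + x (x) y) = (p + x) (x) (q + y) + (p - x) (x) (q - y)]
    ([max_precone_herm]). So [w], plus a small multiple of the unit, is
    minimal-positive over [L], hence over [S m]; by the hypothesis on [S m] it
    lies in the elementary cone there, that is, in the maximal cone over the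
    injective envelope of [S m]. The envelope of [L] being injective, the embedding
    of [S m] in it extends to a unital completely positive map on the envelope of
    [S m], which preserves maximal cones. Adding back the small difference between
    [v] and [w] and using that the maximal cone is additive ([max_preconeD]) and
    Archimedean gives the claim. *)

Set Implicit Arguments.
Unset Strict Implicit.
Unset Printing Implicit Defensive.

Import Order.TTheory GRing.Theory Num.Theory.
Import numFieldNormedType.Exports.

Local Open Scope ring_scope.

(** * Positive sesquilinear forms on finite index sets *)

Lemma sum_pair (V : nmodType) (I J : finType) (F : I * J -> V) :
  \sum_p F p = \sum_i \sum_j F (i, j).
Proof. by rewrite pair_bigA; apply: eq_bigr => -[]. Qed.

Section PositiveForms.
Local Open Scope sesquilinear_scope.
Variable C : numClosedFieldType.

Definition qform (I : finType) (M : I -> I -> C) (h : I -> C) : C :=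
  \sum_p \sum_q (h p)^* * M p q * h q.

Definition psd (I : finType) (M : I -> I -> C) : Prop :=
  forall h, 0 <= qform M h.

(** Evaluate the form at [e_p + c e_q] for [c = 1] and [c = 'i]. *)
Lemma qform_polarization (I : finType) (M : I -> I -> C) :
  (forall h, qform M h = 0) -> forall p q, M p q = 0.
Proof.
move=> M0.
pose e (p : I) : I -> C := fun i => (i == p)%:R.
have eM p (F : I -> C) : \sum_i (e p i)^* * F i = F p.
  rewrite (bigD1 p) //= /e eqxx conjC1 mul1r big1 ?addr0 // => i /negbTE ->.
  by rewrite conjC0 mul0r.
have Me p (F : I -> C) : \sum_i F i * e p i = F p.
  rewrite (bigD1 p) //= /e eqxx mulr1 big1 ?addr0 // => i /negbTE ->.
  by rewrite mulr0.
have E p q c : qform M (fun i => e p i + c * e q i) =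
    M p p + c * M p q + c^* * (M q p + c * M q q).
  rewrite /qform.
  transitivity (\sum_i (e p i)^* * (M i p + c * M i q) +
                c^* * \sum_i (e q i)^* * (M i p + c * M i q)).
    rewrite mulr_sumr -big_split /=; apply: eq_bigr => i _.
    transitivity ((e p i + c * e q i)^* * (\sum_j M i j * e p j +
                    c * \sum_j M i j * e q j)).
      rewrite mulr_sumr -big_split /= mulr_sumr; apply: eq_bigr => j _.
      by rewrite -mulrA mulrDr [M i j * (c * _)]mulrCA.
    by rewrite !Me rmorphD rmorphM mulrDl mulrA.
  by rewrite !eM.
have D p : M p p = 0.
  by have := E p p 0; rewrite M0 rmorph0 !mul0r !addr0 => ->.
move=> p q.
have := E p q 1; rewrite M0 conjC1 !D !mulr0 !mul1r add0r addr0 => e1.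
have := E p q 'i; rewrite M0 conjCi !D !mulr0 add0r addr0 => e2.
have qp : M q p = - M p q by apply/eqP; rewrite -addr_eq0 addrC -e1.
have : 'i * M p q *+ 2 = 0 by rewrite e2 qp mulNr mulrN opprK mulr2n.
move=> /eqP; rewrite mulrn_eq0 /= mulf_eq0 (negbTE (neq0Ci C)).
by move/eqP.
Qed.

Lemma qform_real_sym (I : finType) (M : I -> I -> C) :
  (forall h, qform M h \is Num.real) -> forall p q, M q p = (M p q)^*.
Proof.
move=> Mr p q; apply/esym/eqP; rewrite -subr_eq0; apply/eqP; move: q p.
apply: (qform_polarization (M := fun q p => (M p q)^* - M q p)) => h.
transitivity ((qform M h)^* - qform M h); last first.
  by rewrite (CrealP (Mr h)) subrr.
rewrite /qform rmorph_sum /=.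
under [X in _ = X - _]eq_bigr => p _ do rewrite rmorph_sum /=.
rewrite [X in _ = X - _]exchange_big /= -sumrB; apply: eq_bigr => p _.
rewrite -sumrB; apply: eq_bigr => q _.
by rewrite !rmorphM /= conjCK; ring.
Qed.

(** Unitary diagonalization: the columns of [w] are the eigenvectors, scaled by
    the square roots of the eigenvalues. *)
Lemma psd_sum_squares (I : finType) (M : I -> I -> C) : psd M ->
  exists w : I -> 'I_#|I| -> C, forall p q, M p q = \sum_r w p r * (w q r)^*.
Proof.
move=> M0; have Msym : forall p q, M q p = (M p q)^*.
  by apply: qform_real_sym => h; exact: ger0_real.
pose A : 'M[C]_#|I| := \matrix_(i, j) M (enum_val i) (enum_val j).
have /hermitian_normalmx/orthomx_spectralP : A \is hermsymmx.
  apply/is_hermitianmxP; rewrite expr0 scale1r.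
  by apply/matrixP => i j; rewrite !mxE -Msym.
set P := spectralmx A; set d := spectral_diag A.
have Pu : P \is unitarymx := spectral_unitarymx A.
rewrite invmx_unitary // => AE.
have PAP : P *m A *m P ^t* = diag_mx d.
  by rewrite {1}AE !mulmxA (unitarymxP Pu) mul1mx -mulmxA (unitarymxP Pu) mulmx1.
have d0 r : 0 <= d 0 r.
  suff -> : d 0 r = qform M (fun p => (P r (enum_rank p))^*) by [].
  have := congr1 (fun B : 'M[C]_#|I| => B r r) PAP.
  rewrite !mxE eqxx mulr1n => <-; rewrite /qform [RHS]exchange_big /=.
  rewrite (reindex_onto enum_rank enum_val) /=; last by move=> i _; rewrite enum_valK.
  apply: eq_big => [q|q _]; first by rewrite enum_rankK eqxx.
  rewrite !mxE mulr_suml (reindex_onto enum_rank enum_val) /=; last first.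
    by move=> i _; rewrite enum_valK.
  apply: eq_big => [p|p _]; first by rewrite enum_rankK eqxx.
  by rewrite !mxE conjCK !enum_rankK.
exists (fun p r => (P r (enum_rank p))^* * sqrtC (d 0 r)) => p q.
have := congr1 (fun B : 'M[C]_#|I| => B (enum_rank p) (enum_rank q)) AE.
rewrite !mxE !enum_rankK => ->; apply: eq_bigr => r _.
rewrite mul_mx_diag !mxE /= rmorphM /=.
rewrite conjCK [(sqrtC _)^*](CrealP (ger0_real _)) ?sqrtC_ge0 //.
by rewrite -[in LHS](sqrtCK (d 0 r)); ring.
Qed.

(** Schur product theorem: writing [N] as a sum of squares turns the form of the
    Kronecker product into a sum of values of the form of [M]. *)
Lemma psd_kron (I J : finType) (M : I -> I -> C) (N : J -> J -> C) :
  psd M -> psd N -> psd (fun p q : I * J => M p.1 q.1 * N p.2 q.2).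
Proof.
move=> M0 /psd_sum_squares[w NE] h.
suff -> : qform (fun p q : I * J => M p.1 q.1 * N p.2 q.2) h =
    \sum_r qform M (fun i => \sum_j (w j r)^* * h (i, j)).
  by apply: sumr_ge0 => r _; exact: M0.
rewrite /qform; under eq_bigr => p _ do under eq_bigr => q _ do
  rewrite NE mulr_sumr mulr_sumr mulr_suml.
under eq_bigr do rewrite exchange_big /=.
rewrite exchange_big /=; apply: eq_bigr => r _.
rewrite sum_pair /=; apply: eq_bigr => i _.
rewrite exchange_big /= sum_pair /=.
apply: eq_bigr => i' _; rewrite exchange_big /= rmorph_sum !mulr_suml.
apply: eq_bigr => j _; rewrite mulr_sumr; apply: eq_bigr => j' _ /=.
by rewrite rmorphM /= conjCK; ring.
Qed.

(** Sum the entries of a vector over the fibres of [phi]. This is what lets a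
    positivity statement pass between the various nested index sets below. *)
Lemma psd_pullback (I J : finType) (phi : I -> J)
    (M : J -> J -> C) : psd M -> psd (fun p q => M (phi p) (phi q)).
Proof.
move=> M0 h; pose h' j := \sum_(p | phi p == j) h p.
suff -> : qform (fun p q => M (phi p) (phi q)) h = qform M h' by exact: M0.
rewrite /qform (partition_big phi xpredT) //=; apply: eq_bigr => j _.
rewrite exchange_big (partition_big phi xpredT) //=; apply: eq_bigr => j' _.
rewrite mulr_sumr; apply: eq_bigr => q /eqP <-.
by rewrite rmorph_sum !mulr_suml; apply: eq_bigr => p /eqP <-.
Qed.

(** Positivity of the congruence of [M] by [w (x) 1], read on index pairs. *)
Lemma psd_contract (I J L : finType) (w : I -> J -> C)
    (M : J * L -> J * L -> C) : psd M ->
  psd (fun p q : I * L =>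
    \sum_a \sum_b w p.1 a * M (a, p.2) (b, q.2) * (w q.1 b)^*).
Proof.
have sum4 (A : finType) (F : A * L -> A * L -> C) :
    \sum_p \sum_q F p q = \sum_t \sum_s \sum_a \sum_b F (a, t) (b, s).
  rewrite sum_pair exchange_big; apply: eq_bigr => t _.
  rewrite [RHS]exchange_big; apply: eq_bigr => a _.
  by rewrite sum_pair exchange_big.
move=> M0 h; pose h' p := \sum_i (w i p.1)^* * h (i, p.2).
suff -> : qform (fun p q : I * L =>
    \sum_a \sum_b w p.1 a * M (a, p.2) (b, q.2) * (w q.1 b)^*) h = qform M h'.
  exact: M0.
rewrite /qform !sum4; apply: eq_bigr => t _; apply: eq_bigr => s _ /=.
transitivity (\sum_i \sum_j \sum_a \sum_b (h (i, t))^* * w i a *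
    M (a, t) (b, s) * ((w j b)^* * h (j, s))).
  apply: eq_bigr => i _; apply: eq_bigr => j _.
  rewrite mulr_sumr mulr_suml; apply: eq_bigr => a _.
  by rewrite mulr_sumr mulr_suml; apply: eq_bigr => b _; rewrite !mulrA.
transitivity (\sum_a \sum_b \sum_i \sum_j (h (i, t))^* * w i a *
    M (a, t) (b, s) * ((w j b)^* * h (j, s))).
  under eq_bigr => i _ do rewrite exchange_big.
  rewrite exchange_big; apply: eq_bigr => a _ /=.
  under eq_bigr => i _ do rewrite exchange_big.
  by rewrite exchange_big.
apply: eq_bigr => a _; apply: eq_bigr => b _; rewrite rmorph_sum !mulr_suml.
apply: eq_bigr => i _; rewrite mulr_sumr; apply: eq_bigr => j _.
by rewrite rmorphM /= conjCK [w i a * _]mulrC.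
Qed.

End PositiveForms.

(** * Hilbert spaces *)

Section HilbertFacts.
Variables (R : realType) (H : hilbert R).
Local Notation C := R[i].
Local Notation ip := (inner H).
Implicit Types x y z : H.

Lemma innerDl x y z : ip (x + y) z = ip x z + ip y z.
Proof. exact: linearDl. Qed.

Lemma innerZl a x z : ip (a *: x) z = a * ip x z.
Proof. exact: linearZl_LR. Qed.

Lemma innerDr x y z : ip x (y + z) = ip x y + ip x z.
Proof. exact: linearDr. Qed.

Lemma innerZr a x z : ip x (a *: z) = a^* * ip x z.
Proof. exact: linearZr_LR. Qed.

Lemma innerC x y : ip x y = (ip y x)^*.
Proof. by have := hermC (inner H) x y; rewrite expr0 mul1r. Qed.

Lemma inner_ge0 x : 0 <= ip x x.
Proof. by rewrite -inner_norm exprn_ge0. Qed.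

Lemma inner_CS x y : `|ip x y| <= `|x| * `|y|.
Proof.
have [->|y0] := eqVneq y 0.
  by rewrite (linear0r (inner H)) !normr0 mulr0.
rewrite -(@ler_pXn2r _ 2) ?nnegrE ?mulr_ge0 //.
pose z := ip y y *: x - ip x y *: y.
have yy : 0 < ip y y by rewrite -inner_norm exprn_gt0 // normr_gt0.
have := inner_ge0 z.
have -> : ip z z = ip y y * (ip x x * ip y y - `|ip x y| ^+ 2).
  rewrite /z -scaleNr !(innerDl, innerDr, innerZl, innerZr) normCK rmorphN.
  by rewrite /= -[(ip y y)^*]innerC -[(ip x y)^*]innerC; ring.
by rewrite pmulr_rge0 // subr_ge0 exprMn !inner_norm.
Qed.

Lemma inner_suml (I : Type) (r : seq I) (P : pred I) (F : I -> H) y :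
  ip (\sum_(i <- r | P i) F i) y = \sum_(i <- r | P i) ip (F i) y.
Proof.
apply: (big_morph (fun x => ip x y)) => [x z|]; first exact: innerDl.
exact: (linear0l (inner H)).
Qed.

Lemma inner_sumr (I : Type) (r : seq I) (P : pred I) (F : I -> H) x :
  ip x (\sum_(i <- r | P i) F i) = \sum_(i <- r | P i) ip x (F i).
Proof.
apply: (big_morph (fun y => ip x y)) => [y z|]; first exact: innerDr.
exact: (linear0r (inner H)).
Qed.

Lemma inner_sumlr (I J : finType) (a : I -> C) (b : J -> C) (x : I -> H)
    (y : J -> H) :
  ip (\sum_i a i *: x i) (\sum_j b j *: y j) =
  \sum_i \sum_j a i * (b j)^* * ip (x i) (y j).
Proof.
rewrite inner_suml; apply: eq_bigr => i _.
rewrite inner_sumr; apply: eq_bigr => j _.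
by rewrite innerZl innerZr mulrA.
Qed.

(** Gram-Schmidt orthonormalization. *)
Lemma orthonormal_span (s : seq H) :
  exists p (e : 'I_p -> H), (forall i j, ip (e i) (e j) = (i == j)%:R) /\
    forall h, h \in s -> exists c : 'I_p -> C, h = \sum_j c j *: e j.
Proof.
elim: s => [|x s [p [e [eo es]]]].
  by exists 0, (fun=> 0); split=> // -[].
pose y := x - \sum_j ip x (e j) *: e j.
have ye i : ip y (e i) = 0.
  rewrite /y -scaleN1r innerDl innerZl inner_suml mulN1r.
  rewrite (bigD1 i) //= innerZl eo eqxx mulr1 big1 ?addr0 ?subrr // => j ji.
  by rewrite innerZl eo (negbTE ji) mulr0.
have xE : x = y + \sum_j ip x (e j) *: e j by rewrite subrK.
have [y0|y0] := eqVneq y 0.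
  exists p, e; split=> // h; rewrite inE => /predU1P[->|/es //].
  by exists (fun j => ip x (e j)); rewrite {1}xE y0 add0r.
have ny : `|y| != 0 by rewrite normr_eq0.
pose w := `|y|^-1 *: y.
pose e' (j : 'I_p.+1) := if unlift ord0 j is Some k then e k else w.
have e'0 : e' ord0 = w by rewrite /e' unlift_none.
have e'S k : e' (lift ord0 k) = e k by rewrite /e' liftK.
have we k : ip w (e k) = 0 by rewrite innerZl ye mulr0.
have ww : ip w w = 1 by rewrite -inner_norm normrZ normfV normr_id mulVf ?expr1n.
have span (z : C) (c : 'I_p -> C) : z *: w + \sum_j c j *: e j =
    \sum_j (if unlift ord0 j is Some k then c k else z) *: e' j.
  rewrite big_ord_recl /= unlift_none e'0; congr (_ + _).
  by apply: eq_bigr => j _; rewrite liftK e'S.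
exists p.+1, e'; split=> [i j|h].
  case: (unliftP ord0 i) => [k|] ->; case: (unliftP ord0 j) => [l|] ->.
  - by rewrite !e'S eo (inj_eq lift_inj).
  - by rewrite e'S e'0 innerC we rmorph0 eq_sym (negbTE (neq_lift _ _)).
  - by rewrite e'S e'0 we (negbTE (neq_lift _ _)).
  - by rewrite !e'0 eqxx.
rewrite inE => /predU1P[->|/es[c ->]].
  exists (fun j => if unlift ord0 j is Some k then ip x (e k) else `|y|).
  rewrite -(span `|y| (fun k => ip x (e k))) {1}xE.
  by rewrite scalerA mulfV ?scale1r.
exists (fun j => if unlift ord0 j is Some k then c k else 0).
by rewrite -(span 0 c) scale0r add0r.
Qed.

End HilbertFacts.

(** * Self-adjoint matrices over an operator system *)

Section OperatorSystemFacts.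
Variables (R : realType) (S : opsys R).
Local Notation C := R[i].
Local Notation ip := (inner (os_hilb S)).

Definition os_app (x : S) (h : os_hilb S) : os_hilb S := os_val x h.

Lemma os_appD (x y : S) h : os_app (x + y) h = os_app x h + os_app y h.
Proof. by []. Qed.

Lemma os_appZ a (x : S) h : os_app (a *: x) h = a *: os_app x h.
Proof. by []. Qed.

Lemma os_app1 h : os_app (os_one S) h = h.
Proof. by []. Qed.

Lemma os_app_linear (x : S) : linear (os_app x).
Proof. by have /asboolP /os_bounded[xl _] := os_valP x. Qed.

HB.instance Definition _ (x : S) :=
  GRing.isLinear.Build C (os_hilb S) (os_hilb S) *:%R (os_app x) (os_app_linear x).

Lemma os_app_bounded (x : S) :
  exists2 M : C, 0 < M & forall h, `|os_app x h| <= M * `|h|.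
Proof.
have /asboolP /os_bounded[_ xc] := os_valP x.
have := continuous_linear_bounded 0 (f := os_app x) (xc 0).
by move=> /linear_boundedP /pinfty_ex_gt0[M M0 fM]; exists M.
Qed.

Definition qf n (X : 'M[S]_n) (h : 'I_n -> os_hilb S) : C :=
  \sum_i \sum_j ip (os_app (X i j) (h j)) (h i).

Definition sqnorm n (h : 'I_n -> os_hilb S) : C := \sum_i ip (h i) (h i).

Lemma sqnorm_ge0 n (h : 'I_n -> os_hilb S) : 0 <= sqnorm h.
Proof. by apply: sumr_ge0 => i _; exact: inner_ge0. Qed.

Lemma os_coneE n (X : 'M[S]_n) : os_cone X <-> forall h, 0 <= qf X h.
Proof. by []. Qed.

Lemma qfD n (X Y : 'M[S]_n) h : qf (X + Y) h = qf X h + qf Y h.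
Proof.
rewrite /qf -big_split; apply: eq_bigr => i _; rewrite -big_split.
by apply: eq_bigr => j _; rewrite mxE os_appD innerDl.
Qed.

Lemma qfZ n a (X : 'M[S]_n) h : qf (map_mx ( *:%R a) X) h = a * qf X h.
Proof.
rewrite /qf mulr_sumr; apply: eq_bigr => i _; rewrite mulr_sumr.
by apply: eq_bigr => j _; rewrite mxE os_appZ innerZl.
Qed.

Lemma qfN n (X : 'M[S]_n) h : qf (- X) h = - qf X h.
Proof.
rewrite -mulN1r -qfZ; congr qf; apply/matrixP => i j.
by rewrite !mxE scaleN1r.
Qed.

End OperatorSystemFacts.

Definition scalar_mxv (K : fieldType) (V : lmodType K) (v : V) n (c : K) : 'M[V]_n :=
  \matrix_(i, j) ((c *+ (i == j)) *: v).

Lemma map_scalar_mxv (K : fieldType) (V W : lmodType K) (f : {linear V -> W}) v n c :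
  map_mx f (scalar_mxv v n c) = scalar_mxv (f v) n c.
Proof. by apply/matrixP => i j; rewrite !mxE linearZ. Qed.

Section HermitianMatrices.
Variables (R : realType).
Local Notation C := R[i].

Lemma qf_scalar (S : opsys R) n c (h : 'I_n -> os_hilb S) :
  qf (scalar_mxv (os_one S) n c) h = c * sqnorm h.
Proof.
rewrite /qf /sqnorm mulr_sumr; apply: eq_bigr => i _.
rewrite (bigD1 i) //= mxE eqxx mulr1n os_appZ innerZl big1 ?addr0 // => j ji.
by rewrite mxE eq_sym (negbTE ji) mulr0n scale0r (linear0l (inner (os_hilb S))).
Qed.

(** [X] is self-adjoint, as an operator on [H^n]. *)
Definition qherm (S : opsys R) n (X : 'M[S]_n) : Prop :=
  forall h, qf X h \is Num.real.

(** The numerical radius of [X] is at most [c]. *)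
Definition qdom (S : opsys R) n (X : 'M[S]_n) (c : C) : Prop :=
  forall h, `|qf X h| <= c * sqnorm h.

Lemma qdom_cone (S : opsys R) n (X : 'M[S]_n) (c : C) : qherm X -> qdom X c ->
  os_cone (scalar_mxv (os_one S) n c + X) /\
  os_cone (scalar_mxv (os_one S) n c - X).
Proof.
move=> Xr Xc.
have ler h : - (c * sqnorm h) <= qf X h <= c * sqnorm h.
  by rewrite -real_ler_norml // Xc.
split; apply/os_coneE => h; rewrite qfD ?qfN qf_scalar; have /andP[lo hi] := ler h.
  by rewrite -lerBlDl sub0r.
by rewrite subr_ge0.
Qed.

(** Cauchy-Schwarz, then [2 |h i| |h j| <= |h i|^2 + |h j|^2] to recover the norm
    of the whole vector; this costs the factor [n]. *)
Lemma qdom_entries (S : opsys R) n (X : 'M[S]_n) (m : C) : 0 <= m ->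
  (forall i j h, `|os_app (X i j) h| <= m * `|h|) -> qdom X (m * n%:R).
Proof.
move=> m0 Xm h.
have Xij i j : `|inner (os_hilb S) (os_app (X i j) (h j)) (h i)| <=
    m * (2^-1 * (`|h i| ^+ 2 + `|h j| ^+ 2)).
  apply: le_trans (inner_CS _ _) _.
  apply: (@le_trans _ _ (m * `|h j| * `|h i|)); first by rewrite ler_wpM2r.
  rewrite -mulrA ler_wpM2l // -subr_ge0.
  have -> : 2^-1 * (`|h i| ^+ 2 + `|h j| ^+ 2) - `|h j| * `|h i| =
      2^-1 * (`|h i| - `|h j|) ^+ 2 by field.
  by rewrite mulr_ge0 ?invr_ge0 // real_exprn_even_ge0 // rpredB.
apply: le_trans (ler_norm_sum _ _ _) _.
apply: (@le_trans _ _ (\sum_i \sum_j m * (2^-1 * (`|h i| ^+ 2 + `|h j| ^+ 2)))).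
  apply: ler_sum => i _; apply: le_trans (ler_norm_sum _ _ _) _.
  by apply: ler_sum => j _; exact: Xij.
rewrite le_eqVlt; apply/orP; left; apply/eqP.
have sq : sqnorm h = \sum_i `|h i| ^+ 2.
  by apply: eq_bigr => i _; rewrite inner_norm.
under eq_bigr => i _ do rewrite -!mulr_sumr big_split /= sumr_const card_ord -sq.
rewrite -!mulr_sumr big_split /= sumr_const card_ord sumrMnl -sq.
by rewrite -[sqnorm h *+ n]mulr_natr; field.
Qed.

Lemma os_bounded_entries (S : opsys R) n (X : 'M[S]_n) :
  exists2 m : C, 0 < m & forall i j h, `|os_app (X i j) h| <= m * `|h|.
Proof.
have /all_sig2[M M0 MP] (p : 'I_n * 'I_n) :
    {M : C | 0 < M & forall h, `|os_app (X p.1 p.2) h| <= M * `|h|}.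
  exact: cid2 (os_app_bounded (X p.1 p.2)).
exists (1 + \sum_p M p).
  by rewrite ltr_pwDl // sumr_ge0 // => p _; exact: ltW.
move=> i j h; apply: le_trans (MP (i, j) h) _; rewrite ler_wpM2r //.
rewrite (bigD1 (i, j)) //= addrCA ler_wpDr //.
by rewrite addr_ge0 // sumr_ge0 // => p _; exact: ltW.
Qed.

Lemma qdom_exists (S : opsys R) n (X : 'M[S]_n) : exists2 c : C, 0 < c & qdom X c.
Proof.
have [m m0 Xm] := os_bounded_entries X.
exists (m * n%:R + 1); first by rewrite ltr_wpDl // mulr_ge0 // ltW.
move=> h; apply: le_trans (qdom_entries (ltW m0) Xm h) _.
by rewrite mulrDl mul1r lerDl sqnorm_ge0.
Qed.

(** A self-adjoint matrix becomes positive after adding a large multiple of the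
    unit, and a unital map turns that multiple into a real scalar. *)
Lemma ucp_qherm (S T : opsys R) (f : {linear S -> T}) n (X : 'M[S]_n) :
  ucp f -> qherm X -> qherm (map_mx f X).
Proof.
move=> [f1 fcp] Xr h.
have [c c0 Xc] := qdom_exists X.
have [Xp _] := qdom_cone Xr Xc.
have := fcp _ _ Xp; rewrite map_mxD map_scalar_mxv f1 => /os_coneE/(_ h).
rewrite qfD qf_scalar => /ger0_real; rewrite rpredDl //.
by rewrite ger0_real // mulr_ge0 ?sqnorm_ge0 // ltW.
Qed.

Lemma ucoe_ucp (S T : opsys R) (f : {linear S -> T}) : ucoe f -> ucp f.
Proof. by move=> [f1 _ fP]; split=> // n A /fP. Qed.

Lemma ucp_comp (S T U : opsys R) (f : {linear S -> T}) (g : {linear T -> U}) :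
  ucp f -> ucp g -> ucp (g \o f).
Proof.
move=> [f1 fP] [g1 gP]; split=> [|n A /fP/gP] /=; first by rewrite f1.
by rewrite map_mx_comp.
Qed.

(** Real and imaginary parts: the adjoint matrix of [X] is formed entrywise, from
    the adjoints that the operator system contains. *)
Lemma cartesian_decomposition (S : opsys R) n (X : 'M[S]_n) :
  exists A B : 'M[S]_n,
    [/\ qherm A, qherm B & X = A + map_mx ( *:%R 'i) B].
Proof.
have /all_sig[star starP] (x : S) : {y : S | forall h k,
    inner (os_hilb S) (os_app x h) k = inner (os_hilb S) h (os_app y k)}.
  apply: cid; have /asboolP/os_adjoint[y Sy xy] := os_valP x.
  by exists (OsElt (asboolT Sy)).
pose Y : 'M[S]_n := \matrix_(i, j) star (X j i).
have YE h : qf Y h = (qf X h)^*.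
  rewrite /qf exchange_big rmorph_sum; apply: eq_bigr => i _.
  rewrite rmorph_sum; apply: eq_bigr => j _.
  by rewrite mxE innerC -starP.
have half : (2^-1 : C)^* = 2^-1 by apply: CrealP; rewrite rpredV realn.
exists (map_mx ( *:%R 2^-1) (X + Y)), (map_mx ( *:%R (2^-1 * 'i)) (Y - X)); split.
- move=> h; rewrite qfZ qfD YE; apply/CrealP.
  by rewrite rmorphM rmorphD /= conjCK addrC half.
- move=> h; rewrite qfZ qfD qfN YE; apply/CrealP.
  by rewrite !rmorphM rmorphB /= conjCK half conjCi; ring.
apply/matrixP => i j; rewrite !mxE scalerA.
have -> : 'i * (2^-1 * 'i) = - 2^-1 :> C by rewrite mulrCA -expr2 sqrCi mulrN1.
rewrite scaleNr -scalerBr opprB addrACA subrr addr0.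
by rewrite scalerDr -scalerDl -{1 2}[2^-1]mul1r -splitr scale1r.
Qed.

End HermitianMatrices.

(** * Compressions to finite-dimensional subspaces *)

Section Compressions.
Variables (R : realType) (S : opsys R).
Local Notation C := R[i].
Local Notation ip := (inner (os_hilb S)).

Lemma mx_coneE n k (A : 'M['M[C]_k]_n) :
  mx_cone A <-> psd (fun p q : 'I_n * 'I_k => A p.1 q.1 p.2 q.2).
Proof.
have E (h : 'I_n -> 'cV[C]_k) :
    \sum_i \sum_j ((map_mx Num.conj (h i))^T *m A i j *m h j) 0 0 =
    qform (fun p q : 'I_n * 'I_k => A p.1 q.1 p.2 q.2) (fun p => h p.1 p.2 0).
  rewrite /qform sum_pair; apply: eq_bigr => i _; rewrite exchange_big sum_pair /=.
  apply: eq_bigr => j _; rewrite mxE; apply: eq_bigr => b _.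
  by rewrite mxE mulr_suml; apply: eq_bigr => a _; rewrite !mxE.
split=> A0 h; last by rewrite E.
have := A0 (fun i => \col_a h (i, a)); rewrite E; congr (0 <= _).
by apply: eq_bigr => -[i a] _; apply: eq_bigr => -[j b] _; rewrite !mxE.
Qed.

(** [P x P] for the projection [P] on the span of [e], as a matrix in [e]. *)
Definition compression p (e : 'I_p -> os_hilb S) (x : S) : 'M[C]_p :=
  \matrix_(i, j) ip (os_app x (e j)) (e i).

Fact compression_linear p (e : 'I_p -> os_hilb S) : linear (compression e).
Proof.
by move=> a x y; apply/matrixP => i j; rewrite !mxE os_appD os_appZ innerDl innerZl.
Qed.

HB.instance Definition _ p (e : 'I_p -> os_hilb S) :=
  GRing.isLinear.Build C S 'M[C]_p *:%R (compression e) (compression_linear e).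

Lemma inner_compression p (e : 'I_p -> os_hilb S) (x : S) (a b : 'I_p -> C) :
  ip (os_app x (\sum_j b j *: e j)) (\sum_i a i *: e i) =
  \sum_i \sum_j (a i)^* * compression e x i j * b j.
Proof.
have -> : os_app x (\sum_j b j *: e j) = \sum_j b j *: os_app x (e j).
  by rewrite linear_sum; apply: eq_bigr => j _; rewrite linearZ.
rewrite inner_sumlr exchange_big; apply: eq_bigr => i _; apply: eq_bigr => j _.
by rewrite mxE; ring.
Qed.

Lemma qf_compression p (e : 'I_p -> os_hilb S) n (X : 'M[S]_n)
    (c : 'I_n * 'I_p -> C) :
  qf X (fun i => \sum_a c (i, a) *: e a) =
  qform (fun r s : 'I_n * 'I_p => compression e (X r.1 s.1) r.2 s.2) c.
Proof.
rewrite /qform sum_pair; apply: eq_bigr => i _; rewrite exchange_big sum_pair /=.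
by apply: eq_bigr => j _; rewrite inner_compression exchange_big.
Qed.

Lemma compression_ucp p (e : 'I_p -> os_hilb S) :
  (forall i j, ip (e i) (e j) = (i == j)%:R) -> ucp_mx (compression e).
Proof.
move=> eo; split=> [|n A A0].
  by apply/matrixP => i j; rewrite !mxE os_app1 eo eq_sym.
apply/mx_coneE => c; have := A0 (fun i => \sum_a c (i, a) *: e a).
rewrite -[X in 0 <= X]/(qf _ _) qf_compression; congr (0 <= _).
by apply: eq_bigr => q _; apply: eq_bigr => r _; rewrite !mxE.
Qed.

(** If [x h] is not zero, it is detected by a compression to a subspace that
    contains both [h] and [x h]. *)
Lemma compression_eq0 (x : S) :
  (forall p (e : 'I_p -> os_hilb S), ucp_mx (compression e) -> compression e x = 0) ->
  x = 0.
Proof.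
move=> x0; apply: val_inj; apply/funext => h /=; rewrite -/(os_app x h).
have [p [e [eo es]]] := orthonormal_span [:: h; os_app x h].
have [b hE] := es h (mem_head _ _).
have [a kE] : exists a : 'I_p -> C, os_app x h = \sum_j a j *: e j.
  by apply: es; rewrite !inE eqxx orbT.
have /eqP : ip (os_app x h) (os_app x h) = 0.
  rewrite {2}kE hE inner_compression (x0 _ _ (compression_ucp eo)).
  by apply: big1 => i _; apply: big1 => j _; rewrite mxE mulr0 mul0r.
by rewrite -inner_norm sqrf_eq0 normr_eq0 => /eqP.
Qed.

End Compressions.

(** * Slice maps on the algebraic tensor product *)

Section Slices.
Variable K : fieldType.
Variables V W : lmodType K.

Definition slice_fun (c : {linear W -> K^o}) (v : V) (w : W) : V := c w *: v.

Fact slice_bilinear c : bilinear_for *:%R *:%R (slice_fun c).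
Proof.
split=> [w a v v'|v a w w']; rewrite /slice_fun /=.
  by rewrite scalerDr !scalerA mulrC.
by rewrite linearP scalerDl scalerA.
Qed.

HB.instance Definition _ c :=
  bilinear_isBilinear.Build K V W V *:%R *:%R (slice_fun c) (slice_bilinear c).

Definition slice (c : {linear W -> K^o}) : {linear tensor V W -> V} :=
  sval (cid (tens_universal (slice_fun c))).

Lemma sliceE c v w : slice c (tens v w) = c w *: v.
Proof. by rewrite /slice; case: cid => f [fE _] /=; rewrite fE. Qed.

Definition mx_entry m (g : {linear W -> 'M[K]_m}) (a b : 'I_m) (w : W) : K^o :=
  g w a b.

Fact mx_entry_linear m (g : {linear W -> 'M[K]_m}) a b : linear (mx_entry g a b).
Proof. by move=> c w w'; rewrite /mx_entry linearP !mxE. Qed.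

HB.instance Definition _ m (g : {linear W -> 'M[K]_m}) a b :=
  GRing.isLinear.Build K W K^o *:%R (mx_entry g a b) (mx_entry_linear g a b).

Fact tens_map_mx_linear k m (f : {linear V -> 'M[K]_k}) (g : {linear W -> 'M[K]_m}) :
  linear (tens_map_mx f g).
Proof. by move=> a u u'; apply/matrixP => i j; rewrite !mxE. Qed.

HB.instance Definition _ k m (f : {linear V -> 'M[K]_k}) (g : {linear W -> 'M[K]_m}) :=
  GRing.isLinear.Build K (tensor V W) 'M[K]_(k * m) *:%R (tens_map_mx f g)
    (tens_map_mx_linear f g).

(** An entry of [f (x) g] is obtained by first slicing along an entry of [g]: the
    two factors can be treated one at a time. *)
Lemma tens_map_mx_slice k m (f : {linear V -> 'M[K]_k}) (g : {linear W -> 'M[K]_m})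
    u (p q : 'I_(k * m)) :
  tens_map_mx f g u p q =
  f (slice (mx_entry g (mxtens_unindex p).2 (mxtens_unindex q).2) u)
    (mxtens_unindex p).1 (mxtens_unindex q).1.
Proof.
have [s ->] := tensP u; rewrite !linear_sum !summxE; apply: eq_bigr => r _.
by rewrite /= tens_map_mxE sliceE linearZ !mxE mulrC.
Qed.

End Slices.

Arguments slice {K V W} c.

Lemma slice_tens_map (K : fieldType) (V V' W : lmodType K) (f : {linear V -> V'})
    (c : {linear W -> K^o}) (u : tensor V W) :
  slice c (tens_map f (idfun : W -> W) u) = f (slice c u).
Proof.
have [s ->] := tensP u; rewrite !linear_sum; apply: eq_bigr => r _.
by rewrite /= tens_mapE !sliceE linearZ.
Qed.

(** * The minimal cone *)

Lemma sum_mxtens (V : nmodType) k m (F : 'I_(k * m) -> V) :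
  \sum_r F r = \sum_a \sum_b F (mxtens_index (a, b)).
Proof.
rewrite (reindex (@mxtens_index k m)) ?sum_pair //.
by exists (@mxtens_unindex k m) => r _; rewrite (mxtens_indexK, mxtens_unindexK).
Qed.

Lemma mx0E (V : nmodType) m n i j : (0 : 'M[V]_(m, n)) i j = 0.
Proof. by rewrite mxE. Qed.

Section MinCone.
Variable R : realType.
Local Notation C := R[i].

(** The matrix over [S] obtained by applying [id (x) g] to the entries of [u]. *)
Definition slice_mx (S T : opsys R) m (g : {linear T -> 'M[C]_m}) n
    (u : 'M[tensor S T]_n) : 'M[S]_(n * m) :=
  \matrix_(r, s) slice (mx_entry g (mxtens_unindex r).2 (mxtens_unindex s).2)
                       (u (mxtens_unindex r).1 (mxtens_unindex s).1).

(** Testing an element on all [f (x) g] amounts to slicing it along each [g] and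
    testing positivity over [S] itself. For the direct implication, a vector of
    the Hilbert space of [S], with [n * m] coordinates, lies in a
    finite-dimensional subspace, and compressing to it is an admissible [f]; the
    converse is the complete positivity of [f]. *)
Lemma min_coneP (S T : opsys R) n (u : 'M[tensor S T]_n) :
  min_cone u <-> forall m (g : {linear T -> 'M[C]_m}),
    ucp_mx g -> os_cone (slice_mx g u).
Proof.
split=> [u0 m g gP h|u0 k m f g [f1 fP] gP].
  rewrite -[X in 0 <= X]/(qf _ _).
  have [p [e [eo es]]] := orthonormal_span (codom h).
  have /all_sig[c hE] (r : 'I_(n * m)) : {c : 'I_p -> C | h r = \sum_a c a *: e a}.
    by apply/cid/es/codom_f.
  have -> : h = fun r => \sum_a c r a *: e a by apply/funext.
  rewrite (qf_compression e (slice_mx g u) (fun r => c r.1 r.2)).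
  have /mx_coneE/(psd_pullback (fun r : 'I_(n * m) * 'I_p =>
    ((mxtens_unindex r.1).1, mxtens_index (r.2, (mxtens_unindex r.1).2)))) :=
    u0 _ _ _ _ (compression_ucp eo) gP.
  move=> /(_ (fun r => c r.1 r.2)); congr (0 <= _).
  apply: eq_bigr => r _; apply: eq_bigr => s _; congr (_ * _ * _).
  rewrite mxE tens_map_mx_slice !mxtens_indexK.
  by rewrite [slice_mx _ _ _ _]mxE.
have /fP/mx_coneE/(psd_pullback (fun p : 'I_n * 'I_(k * m) =>
    (mxtens_index (p.1, (mxtens_unindex p.2).2), (mxtens_unindex p.2).1))) :=
  u0 m g gP.
move=> uf; apply/mx_coneE => h; have := uf h; congr (0 <= _).
apply: eq_bigr => p _; apply: eq_bigr => q _; congr (_ * _ * _).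
rewrite [map_mx (tens_map_mx f g) _ _ _]mxE tens_map_mx_slice.
by rewrite [map_mx f _ _ _]mxE [slice_mx _ _ _ _]mxE !mxtens_indexK.
Qed.

(** The minimal cone is inherited by operator subsystems. Because [min_coneP] lets
    the first factor enter only through its own matrix cones, no extension of
    completely positive maps is involved. *)
Lemma min_cone_ucoe (S S' T : opsys R) (j : {linear S -> S'}) n
    (u : 'M[tensor S T]_n) : ucoe j ->
  min_cone (map_mx (tens_map j (idfun : T -> T)) u) -> min_cone u.
Proof.
move=> [_ _ jP] /min_coneP u0; apply/min_coneP => m g gP.
apply/jP; have := u0 m g gP; congr os_cone.
by apply/matrixP => r s; rewrite !mxE slice_tens_map.
Qed.

End MinCone.

(** * The maximal cone *)

Definition tens_mxl (K : fieldType) (V W : lmodType K) n (X : 'M[V]_n) (y : W) :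
    'M[tensor V W]_n := map_mx (fun x => tens x y) X.

Lemma positive_complex (R : realType) (c : R[i]) :
  0 < c -> exists2 e : R, 0 < e & c = e%:C%C.
Proof.
move=> c0; exists (complex.Re c); last by rewrite RRe_real ?gtr0_real.
by move: c0; rewrite ltcE => /andP[].
Qed.

Section MaxCone.
Variable R : realType.
Local Notation C := R[i].

(** Indexing by pairs instead of by ['I_(k * m)] makes block decompositions of [P]
    and [Q] visible. *)
Lemma max_preconeP (S T : opsys R) n (u : 'M[tensor S T]_n) :
  max_precone u <-> exists k m (P : 'M[S]_k) (Q : 'M[T]_m) (w : 'I_n -> 'M[C]_(k, m)),
    [/\ os_cone P, os_cone Q & forall i j, u i j =
      \sum_a \sum_b \sum_a' \sum_b' (w i a b * (w j a' b')^*) *: tens (P a a') (Q b b')].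
Proof.
split=> [[k [m [P [Q [w [P0 Q0 ->]]]]]]|[k [m [P [Q [w [P0 Q0 uE]]]]]]].
  exists k, m, P, Q, (fun i => \matrix_(a, b) w i (mxtens_index (a, b))).
  split=> // i j; rewrite mxE sum_mxtens; apply: eq_bigr => a _; apply: eq_bigr => b _.
  rewrite sum_mxtens; apply: eq_bigr => a' _; apply: eq_bigr => b' _.
  by rewrite !mxE !mxtens_indexK.
exists k, m, P, Q, (\matrix_(i, r) w i (mxtens_unindex r).1 (mxtens_unindex r).2).
split=> //; apply/matrixP => i j; rewrite uE mxE sum_mxtens.
apply: eq_bigr => a _; apply: eq_bigr => b _; rewrite sum_mxtens.
apply: eq_bigr => a' _; apply: eq_bigr => b' _.
by rewrite !mxE !mxtens_indexK.
Qed.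

Lemma qf_block (S : opsys R) k1 k2 (P1 : 'M[S]_k1) (P2 : 'M[S]_k2) h :
  qf (block_mx P1 0 0 P2) h =
  qf P1 (fun i => h (lshift _ i)) + qf P2 (fun i => h (rshift _ i)).
Proof.
have app0 (x : os_hilb S) : os_app 0 x = 0 by [].
rewrite /qf big_split_ord /=; congr (_ + _); apply: eq_bigr => i _.
  rewrite big_split_ord /= [X in _ + X]big1 ?addr0 => [|j _].
    by apply: eq_bigr => j _; rewrite block_mxEul.
  by rewrite block_mxEur mx0E app0 (linear0l (inner _)).
rewrite big_split_ord /= big1 ?add0r => [|j _].
  by apply: eq_bigr => j _; rewrite block_mxEdr.
by rewrite block_mxEdl mx0E app0 (linear0l (inner _)).
Qed.

Lemma sum_block_diag (V : nmodType) k1 k2 m1 m2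
    (F : 'I_(k1 + k2) -> 'I_(m1 + m2) -> V) :
  (forall a b, F (lshift _ a) (rshift _ b) = 0) ->
  (forall a b, F (rshift _ a) (lshift _ b) = 0) ->
  \sum_a \sum_b F a b = \sum_a \sum_b F (lshift _ a) (lshift _ b) +
                        \sum_a \sum_b F (rshift _ a) (rshift _ b).
Proof.
move=> F12 F21; rewrite big_split_ord; congr (_ + _); apply: eq_bigr => a _.
  by rewrite big_split_ord /= [X in _ + X]big1 ?addr0.
by rewrite big_split_ord /= big1 ?add0r.
Qed.

(** Use the diagonal sums [P1 (+) P2] and [Q1 (+) Q2]; the compressing matrix
    vanishes on the two mixed blocks of their tensor product. *)
Lemma max_preconeD (S T : opsys R) n (u v : 'M[tensor S T]_n) :
  max_precone u -> max_precone v -> max_precone (u + v).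
Proof.
move=> /max_preconeP[k1 [m1 [P1 [Q1 [w1 [P10 Q10 uE]]]]]].
move=> /max_preconeP[k2 [m2 [P2 [Q2 [w2 [P20 Q20 vE]]]]]].
apply/max_preconeP; exists (k1 + k2)%N, (m1 + m2)%N.
exists (block_mx P1 0 0 P2), (block_mx Q1 0 0 Q2).
exists (fun i => block_mx (w1 i) 0 0 (w2 i)); split.
- by apply/os_coneE => h; rewrite qf_block addr_ge0 //; [exact: P10|exact: P20].
- by apply/os_coneE => h; rewrite qf_block addr_ge0 //; [exact: Q10|exact: Q20].
move=> i j; rewrite mxE uE vE sum_block_diag => [|a b|a b].
- congr (_ + _); apply: eq_bigr => a _; apply: eq_bigr => b _.
    rewrite sum_block_diag => [|a' b'|a' b'].
    + rewrite [X in _ + X]big1 ?addr0 => [|a' _].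
        by apply: eq_bigr => a' _; apply: eq_bigr => b' _; rewrite !block_mxEul.
      by apply: big1 => b' _; rewrite !block_mxEur mx0E (linear0l (@tens _ _ _)) scaler0.
    + by rewrite !block_mxEur mx0E rmorph0 mulr0 scale0r.
    + by rewrite !block_mxEdl mx0E rmorph0 mulr0 scale0r.
  rewrite sum_block_diag => [|a' b'|a' b'].
  + rewrite [X in X + _]big1 ?add0r => [|a' _].
      by apply: eq_bigr => a' _; apply: eq_bigr => b' _; rewrite !block_mxEdr.
    by apply: big1 => b' _; rewrite !block_mxEdl mx0E (linear0l (@tens _ _ _)) scaler0.
  + by rewrite block_mxEur mx0E rmorph0 mulr0 scale0r.
  + by rewrite block_mxEdl mx0E rmorph0 mulr0 scale0r.
- by rewrite big1 // => a' _; rewrite big1 // => b' _;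
     rewrite block_mxEur mx0E mul0r scale0r.
- by rewrite big1 // => a' _; rewrite big1 // => b' _;
     rewrite block_mxEdl mx0E mul0r scale0r.
Qed.

Lemma max_precone_tens (S T : opsys R) n (X : 'M[S]_n) (y : T) :
  os_cone X -> os_cone (const_mx y : 'M[T]_1) ->
  max_precone (tens_mxl X y).
Proof.
move=> X0 y0; apply/max_preconeP; exists n, 1%N, X, (const_mx y).
exists (fun i => \matrix_(a, b) (a == i)%:R); split=> // i j.
rewrite mxE (bigD1 i) //= [X in _ + X]big1 ?addr0 => [|a ai].
  rewrite big_ord1 (bigD1 j) //= [X in _ + X]big1 ?addr0 => [|a ai].
    rewrite big_ord1 !mxE !eqxx.
    by rewrite conjC1 mulr1 scale1r.
  by rewrite big_ord1 !mxE (negbTE ai) rmorph0 mulr0 scale0r.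
rewrite big_ord1 big1 // => a' _.
by rewrite big_ord1 !mxE (negbTE ai) mul0r scale0r.
Qed.

Lemma max_precone_cp (S S' T : opsys R) (f : {linear S -> S'}) n
    (u : 'M[tensor S T]_n) : cp (@os_cone R S) (@os_cone R S') f ->
  max_precone u -> max_precone (map_mx (tens_map f (idfun : T -> T)) u).
Proof.
move=> fP /max_preconeP[k [m [P [Q [w [P0 Q0 uE]]]]]]; apply/max_preconeP.
exists k, m, (map_mx f P), Q, w; split=> // [|i j]; first exact: fP.
rewrite mxE uE !linear_sum; apply: eq_bigr => a _.
rewrite linear_sum; apply: eq_bigr => b _; rewrite linear_sum; apply: eq_bigr => a' _.
rewrite linear_sum; apply: eq_bigr => b' _.
by rewrite linearZ /= tens_mapE mxE.
Qed.

(** The values of [f (x) g] on such an element are compressions of a Kronecker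
    product of two positive matrices. *)
Lemma max_precone_min (S T : opsys R) n (u : 'M[tensor S T]_n) :
  max_precone u -> min_cone u.
Proof.
move=> /max_preconeP[k [m [P [Q [w [P0 Q0 uE]]]]]] k' m' f g [_ fP] [_ gP].
have /mx_coneE P1 := fP _ _ P0; have /mx_coneE Q1 := gP _ _ Q0.
apply/mx_coneE.
have /(psd_pullback (fun p : ('I_k * 'I_m) * 'I_(k' * m') =>
    ((p.1.1, (mxtens_unindex p.2).1), (p.1.2, (mxtens_unindex p.2).2)))) :=
  psd_kron P1 Q1.
move=> /(psd_contract (fun (i : 'I_n) a => w i a.1 a.2)) uw h.
have := uw h; congr (0 <= _).
apply: eq_bigr => p _; apply: eq_bigr => q _; congr (_ * _ * _).
rewrite [map_mx _ _ _ _]mxE uE !linear_sum summxE sum_pair; apply: eq_bigr => a _.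
rewrite linear_sum summxE; apply: eq_bigr => b _.
rewrite linear_sum summxE sum_pair; apply: eq_bigr => a' _.
rewrite linear_sum summxE; apply: eq_bigr => b' _.
rewrite linearZ /= tens_map_mxE !mxE /=; ring.
Qed.

Lemma max_coneP (S T : opsys R) n (u : 'M[tensor S T]_n) :
  max_cone u <-> forall e : C, 0 < e ->
    max_precone (u + scalar_mxv (tens (os_one S) (os_one T)) n e).
Proof.
have E (e : C) : (\matrix_(i, j) (u i j + (e *+ (i == j)) *: tens (os_one S) (os_one T)))
    = u + scalar_mxv (tens (os_one S) (os_one T)) n e.
  by apply/matrixP => i j; rewrite !mxE.
split=> [u0 e e0|u0 e e0]; last by rewrite E; apply: u0; rewrite ltcR.
have [e' e'0 ->] := positive_complex e0.
by rewrite -E; exact: u0.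
Qed.

(** By unitality of [g], slicing sends the unit of the tensor product to that of
    [S], so the perturbation by [e] can be removed inside the cone of [S]. *)
Lemma max_cone_min (S T : opsys R) n (u : 'M[tensor S T]_n) :
  max_cone u -> min_cone u.
Proof.
move=> /max_coneP u0; apply/min_coneP => m g gP; apply/os_coneE => h.
have ue e : 0 < e -> 0 <= qf (slice_mx g u) h + e * sqnorm h.
  move=> e0; have /max_precone_min/min_coneP/(_ m g gP)/os_coneE/(_ h) := u0 e e0.
  rewrite -(qf_scalar e) -qfD; congr (0 <= qf _ h).
  apply/matrixP => r s; rewrite !mxE linearD; congr (_ + _).
  rewrite linearZ /= sliceE /= /mx_entry. rewrite gP.1 mxE scalerA; congr (_ *: _).
  rewrite -(can_eq (@mxtens_unindexK n m)) /mxtens_unindex xpair_eqE.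
  by do 2!case: eqVneq => _; rewrite ?mulr1 ?mulr0 ?mul0r.
have s1 : 0 < sqnorm h + 1 by rewrite ltr_wpDl ?sqnorm_ge0.
have xr : qf (slice_mx g u) h \is Num.real.
  have := ger0_real (ue 1 ltr01); rewrite rpredDr // mul1r ger0_real //.
  exact: sqnorm_ge0.
(* A negative value [x] contradicts [ue] at [e = - x / (sqnorm h + 1)]. *)
rewrite real_leNgt ?real0 //; apply/negP => x0.
have := ue (- qf (slice_mx g u) h / (sqnorm h + 1)).
rewrite divr_gt0 ?oppr_gt0 // => /(_ isT).
have -> : qf (slice_mx g u) h + - qf (slice_mx g u) h / (sqnorm h + 1) * sqnorm h =
  qf (slice_mx g u) h / (sqnorm h + 1) by field; rewrite gt_eqF.
by rewrite pmulr_lge0 ?invr_gt0 // => /(lt_le_trans x0); rewrite ltxx.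
Qed.

End MaxCone.

(** * Separation of the tensor product by matrix-valued maps *)

Section Separation.
Variable R : realType.
Local Notation C := R[i].

(** Induction on the length of a representation of [z] as a sum of elementary
    tensors [x (x) y]. Either the second member of the first one vanishes, or
    some slice does not kill it, and then the vanishing of that slice of [z]
    expresses [x] through the first members of the others. *)
Lemma tensor_slice_eq0 (V : lmodType C) (T : opsys R) (z : tensor V T) :
  (forall m (g : {linear T -> 'M[C]_m}) a b, ucp_mx g ->
     slice (mx_entry g a b) z = 0) -> z = 0.
Proof.
have [s ->] := tensP z => zs.
have {zs} : forall m (g : {linear T -> 'M[C]_m}) a b, ucp_mx g ->
    \sum_(p <- s) g p.2 a b *: p.1 = 0.
  move=> m g a b gP; rewrite -[RHS](zs m g a b gP) linear_sum.
  by apply: eq_bigr => p _; rewrite /= sliceE.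
have [N] := ubnP (size s); elim: N s => // N IH [|[x y] s] /= sN s0.
  by rewrite big_nil.
have [y0|] := pselect (forall m (g : {linear T -> 'M[C]_m}), ucp_mx g -> g y = 0).
  have -> : y = 0 by apply: compression_eq0 => p e eP; exact: y0.
  rewrite big_cons /= (linear0r (@tens _ _ _)) add0r; apply: IH => // m g a b gP.
  by rewrite -[RHS](s0 m g a b gP) big_cons /= (y0 m g gP) mxE scale0r add0r.
move=> /existsNP[m0 /existsNP[g0 /not_implyP[g0P /eqP/matrix0Pn[a0 [b0 c0]]]]].
pose k (p : V * T) := - ((g0 y a0 b0)^-1 * g0 p.2 a0 b0).
have xE : x = \sum_(p <- s) k p *: p.1.
  have := s0 _ _ a0 b0 g0P; rewrite big_cons /= => /eqP.
  rewrite addr_eq0 => /eqP xs.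
  rewrite -[x]scale1r -(mulVf c0) -scalerA xs scalerN scaler_sumr -sumrN.
  by apply: eq_bigr => p _; rewrite scalerA scaleNr.
pose s' := [seq (p.1, p.2 + k p *: y) | p <- s].
have -> : \sum_(p <- (x, y) :: s) tens p.1 p.2 = \sum_(p <- s') tens p.1 p.2.
  rewrite big_cons /= [X in tens X]xE big_map (linear_sumlz (@tens _ _ _)).
  rewrite addrC -big_split; apply: eq_bigr => p _ /=.
  by rewrite linearDr linearZl_LR linearZr_LR.
apply: IH => [|m g a b gP]; first by rewrite size_map.
rewrite big_map -[RHS](s0 m g a b gP) big_cons /= [X in _ *: X + _]xE.
rewrite addrC scaler_sumr -big_split; apply: eq_bigr => p _ /=.
by rewrite linearD linearZ !mxE scalerDl scalerA [k p * _]mulrC.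
Qed.

Definition mform n k (A : 'M['M[C]_k]_n) (h : 'I_n * 'I_k -> C) : C :=
  qform (fun p q => A p.1 q.1 p.2 q.2) h.

Lemma mformD n k (A B : 'M['M[C]_k]_n) h : mform (A + B) h = mform A h + mform B h.
Proof.
rewrite /mform /qform -big_split; apply: eq_bigr => p _; rewrite -big_split.
by apply: eq_bigr => q _; rewrite !mxE /=; ring.
Qed.

Lemma mformZ n k (a : C) (A : 'M['M[C]_k]_n) h :
  mform (map_mx ( *:%R a) A) h = a * mform A h.
Proof.
rewrite /mform /qform mulr_sumr; apply: eq_bigr => p _; rewrite mulr_sumr.
by apply: eq_bigr => q _; rewrite !mxE; ring.
Qed.

Lemma min_coneD (S T : opsys R) n (u v : 'M[tensor S T]_n) :
  min_cone u -> min_cone v -> min_cone (u + v).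
Proof.
move=> u0 v0 k m f g fP gP; apply/mx_coneE => h.
rewrite map_mxD -[X in 0 <= X]/(mform _ _) mformD addr_ge0 //.
  by move: h; apply/mx_coneE; exact: u0.
by move: h; apply/mx_coneE; exact: v0.
Qed.

Lemma tensor_mform_eq0 (S T : opsys R) n (z : 'M[tensor S T]_n) :
  (forall k m (f : {linear S -> 'M[C]_k}) (g : {linear T -> 'M[C]_m}) h,
     ucp_mx f -> ucp_mx g -> mform (map_mx (tens_map_mx f g) z) h = 0) ->
  z = 0.
Proof.
move=> z0; apply/matrixP => i j; rewrite mx0E.
apply: tensor_slice_eq0 => m g a b gP; apply: compression_eq0 => p e eP.
apply/matrixP => c d; rewrite mx0E.
have : map_mx (tens_map_mx (compression e) g) z i j
    (mxtens_index (c, a)) (mxtens_index (d, b)) = 0.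
  exact: (qform_polarization (fun h => z0 _ _ _ _ h eP gP)
    (i, mxtens_index (c, a)) (j, mxtens_index (d, b))).
by rewrite [map_mx _ _ _ _]mxE tens_map_mx_slice !mxtens_indexK.
Qed.

End Separation.

(** * Self-adjoint elements of the tensor product *)

Section HermitianTensors.
Variable R : realType.
Local Notation C := R[i].

Definition os_herm (T : opsys R) (y : T) : Prop := qherm (const_mx y : 'M[T]_1).

Local Notation one2 S T := (tens (os_one S) (os_one T)).

Lemma tens_mxl_scalar (S T : opsys R) n c :
  tens_mxl (scalar_mxv (os_one S) n c) (os_one T) = scalar_mxv (one2 S T) n c.
Proof. by apply/matrixP => i j; rewrite !mxE linearZl_LR. Qed.

Lemma scalar_mxvD (K : fieldType) (V : lmodType K) (v : V) n (c d : K) :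
  scalar_mxv v n (c + d) = scalar_mxv v n c + scalar_mxv v n d.
Proof. by apply/matrixP => i j; rewrite !mxE mulrnDl scalerDl. Qed.

Lemma max_precone_scalar (S T : opsys R) n (c : C) : 0 <= c ->
  max_precone (scalar_mxv (one2 S T) n c).
Proof.
move=> c0; rewrite -tens_mxl_scalar; apply: max_precone_tens => h.
  by rewrite -[X in 0 <= X]/(qf _ _) qf_scalar mulr_ge0 ?sqnorm_ge0.
by rewrite !big_ord1 mxE inner_ge0.
Qed.

(** Serves to replace a product of self-adjoint factors by products of positive
    ones. *)
Lemma tens_sum_diff (K : fieldType) (V W : lmodType K) (p x : V) (q y : W) :
  tens (p + x) (q + y) + tens (p - x) (q - y) = (tens p q + tens x y) *+ 2.
Proof.
rewrite [tens (p + x) _]linearDl [tens (p - x) _]linearBl !linearDr.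
rewrite !linearNr opprB addrACA.
rewrite [tens p q + tens p y + _]addrACA subrr addr0.
rewrite [tens x q + _]addrC [tens x y + tens x q + _]addrACA subrr addr0.
by rewrite -!mulr2n mulrnDl.
Qed.

(** As [a] and [b] dominate [X] and [y], both products on the left of
    [tens_sum_diff] have positive factors when [p = a 1] and [q = b 1]. So a tensor
    of self-adjoint elements is absorbed by the unit times the product of their
    bounds. *)
Lemma max_precone_herm (S T : opsys R) n (X : 'M[S]_n) (y : T) (a b : C) :
  qherm X -> qdom X a -> os_herm y -> qdom (const_mx y : 'M[T]_1) b ->
  max_precone (scalar_mxv (one2 S T) n (a * b) + tens_mxl X y).
Proof.
move=> /qdom_cone/[apply] -[Xp Xm] /qdom_cone/[apply] -[yp ym].
have half (Y : 'M[S]_n) : os_cone Y -> os_cone (map_mx ( *:%R 2^-1) Y).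
  by move=> Y0 h; rewrite -[X in 0 <= X]/(qf _ _) qfZ mulr_ge0 ?invr_ge0 ?Y0.
have c1 (z : T) : scalar_mxv (os_one T) 1 b + const_mx z = const_mx (b *: os_one T + z).
  by apply/matrixP => i j; rewrite !mxE !ord1.
have -> : scalar_mxv (one2 S T) n (a * b) + tens_mxl X y =
  tens_mxl (map_mx ( *:%R 2^-1) (scalar_mxv (os_one S) n a + X)) (b *: os_one T + y) +
  tens_mxl (map_mx ( *:%R 2^-1) (scalar_mxv (os_one S) n a - X)) (b *: os_one T - y).
  apply/matrixP => i j; rewrite !mxE.
  set p := _ *: os_one S; set x := X i j; set q := b *: os_one T.
  have -> : (a * b *+ (i == j)) *: one2 S T = tens p q.
    by rewrite /p /q linearZl_LR linearZr_LR /= scalerA mulrnAl.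
  rewrite [tens (2^-1 *: (p + x)) _]linearZl_LR [tens (2^-1 *: (p - x)) _]linearZl_LR /=.
  rewrite -scalerDr tens_sum_diff.
  by rewrite mulr2n scalerDr -scalerDl -[2^-1]mul1r -splitr scale1r.
apply: max_preconeD; apply: max_precone_tens; rewrite -?c1;
  [exact: half|exact: yp|exact: half|].
rewrite (_ : scalar_mxv _ _ _ + _ = scalar_mxv (os_one T) 1 b - const_mx y) //.
by apply/matrixP => i j; rewrite !mxE.
Qed.

Lemma max_precone_herm_sum (S T : opsys R) n N (X : 'I_N -> 'M[S]_n) (y : 'I_N -> T)
    (a b : 'I_N -> C) (c : C) :
  (forall i, [/\ qherm (X i), qdom (X i) (a i), os_herm (y i) &
              qdom (const_mx (y i) : 'M[T]_1) (b i)]) ->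
  \sum_i a i * b i <= c ->
  max_precone (scalar_mxv (one2 S T) n c + \sum_i tens_mxl (X i) (y i)).
Proof.
move=> Xy; rewrite -subr_ge0; set s := \sum_i a i * b i => cs.
have -> : c = (c - s) + s by rewrite subrK.
rewrite scalar_mxvD -addrA; apply: max_preconeD; first exact: max_precone_scalar.
have -> : scalar_mxv (one2 S T) n s = \sum_i scalar_mxv (one2 S T) n (a i * b i).
  rewrite /s; apply: (big_morph (scalar_mxv (one2 S T) n)).
    exact: scalar_mxvD.
  by apply/matrixP => i j; rewrite !mxE mul0rn scale0r.
rewrite -big_split; apply: big_ind => [||i _].
- rewrite (_ : 0 = scalar_mxv (one2 S T) n 0); first exact: max_precone_scalar.
  by apply/matrixP => i j; rewrite !mxE mul0rn scale0r.
- exact: max_preconeD.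
- by case: (Xy i) => *; exact: max_precone_herm.
Qed.

Lemma qhermN (S : opsys R) n (X : 'M[S]_n) : qherm X -> qherm (- X).
Proof. by move=> Xr h; rewrite qfN rpredN. Qed.

Lemma qdomN (S : opsys R) n (X : 'M[S]_n) c : qdom X c -> qdom (- X) c.
Proof. by move=> Xc h; rewrite qfN normrN. Qed.

Lemma tens_mxlN (K : fieldType) (V W : lmodType K) n (X : 'M[V]_n) (y : W) :
  tens_mxl (- X) y = - tens_mxl X y.
Proof. by apply/matrixP => i j; rewrite !mxE linearNl. Qed.

Lemma max_precone_herm_sumN (S T : opsys R) n N (X : 'I_N -> 'M[S]_n) (y : 'I_N -> T)
    (a b : 'I_N -> C) (c : C) :
  (forall i, [/\ qherm (X i), qdom (X i) (a i), os_herm (y i) &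
              qdom (const_mx (y i) : 'M[T]_1) (b i)]) ->
  \sum_i a i * b i <= c ->
  max_precone (scalar_mxv (one2 S T) n c - \sum_i tens_mxl (X i) (y i)).
Proof.
move=> Xy cs; rewrite -sumrN; under eq_bigr do rewrite -tens_mxlN.
apply: max_precone_herm_sum cs => i; have [Xh Xd yh yd] := Xy i.
by split=> //; [exact: qhermN|exact: qdomN].
Qed.

(** The self-adjointness of the [y i] is free: the two parts of a second factor
    are separated, the scalar ['i] going to the first factor. *)
Lemma tensor_mx_sum (S T : opsys R) n (u : 'M[tensor S T]_n) :
  exists N (X : 'I_N -> 'M[S]_n) (y : 'I_N -> T),
    (forall i, os_herm (y i)) /\ u = \sum_i tens_mxl (X i) (y i).
Proof.
pose Q (v : 'M[tensor S T]_n) := exists2 s : seq ('M[S]_n * T),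
  (forall p, p \in s -> os_herm p.2) & v = \sum_(p <- s) tens_mxl p.1 p.2.
suff [s sh ->] : Q u.
  exists (size s), (fun i => (tnth (in_tuple s) i).1), (fun i => (tnth (in_tuple s) i).2).
  by split=> [i|]; [apply: sh; exact: mem_tnth|rewrite (big_tnth _ _ s)].
have Q0 : Q 0 by exists [::] => //; rewrite big_nil.
have QD v w : Q v -> Q w -> Q (v + w).
  move=> [s sh ->] [t th ->]; exists (s ++ t); last by rewrite big_cat.
  by move=> p; rewrite mem_cat => /orP[/sh|/th].
pose E i j (z : tensor S T) : 'M[tensor S T]_n :=
  \matrix_(k, l) if (k == i) && (l == j) then z else 0.
have -> : u = \sum_i \sum_j E i j (u i j).
  apply/matrixP => k l; rewrite summxE (bigD1 k) //= summxE (bigD1 l) //= mxE !eqxx.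
  rewrite big1 => [|j /negbTE jl]; last by rewrite mxE eq_sym jl andbF.
  rewrite big1 ?addr0 // => i /negbTE ik; rewrite summxE big1 // => j _.
  by rewrite mxE eq_sym ik.
apply: big_ind => // i _; apply: big_ind => // j _.
have [s ->] := tensP (u i j).
have -> : E i j (\sum_(p <- s) tens p.1 p.2) = \sum_(p <- s) E i j (tens p.1 p.2).
  apply: (big_morph (E i j)) => [z w|]; apply/matrixP => k l; rewrite !mxE.
    by case: ifP; rewrite ?addr0.
  by case: ifP.
apply: big_ind => // -[x y] _ /=.
have [A [B [Ah Bh yE]]] := cartesian_decomposition (const_mx y : 'M[T]_1).
pose X : 'M[S]_n := \matrix_(k, l) if (k == i) && (l == j) then x else 0.
have c1 (D : 'M[T]_1) : D = const_mx (D 0 0).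
  by apply/matrixP => k l; rewrite mxE !ord1.
exists [:: (X, A 0 0); (map_mx ( *:%R 'i) X, B 0 0)].
  by move=> p; rewrite !inE => /orP[] /eqP->; rewrite /os_herm /= -c1.
have := congr1 (fun D : 'M[T]_1 => D 0 0) yE; rewrite !mxE => ->.
rewrite big_cons big_seq1; apply/matrixP => k l; rewrite !mxE /=.
case: ifP => _; last by rewrite scaler0 !(linear0l (@tens _ _ _)) addr0.
by rewrite linearDr linearZr_LR linearZl_LR.
Qed.

(** Such a sum is half the difference of two elements of the maximal cone, on
    which the form takes nonnegative values. *)
Lemma max_precone_real (S T : opsys R) n N (X : 'I_N -> 'M[S]_n) (y : 'I_N -> T)
    k m (f : {linear S -> 'M[C]_k}) (g : {linear T -> 'M[C]_m}) h :
  (forall i, qherm (X i)) -> (forall i, os_herm (y i)) -> ucp_mx f -> ucp_mx g ->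
  mform (map_mx (tens_map_mx f g) (\sum_i tens_mxl (X i) (y i))) h \is Num.real.
Proof.
move=> Xh yh fP gP; set v := \sum_i _.
have /all_sig2[a _ Xa] i := cid2 (qdom_exists (X i)).
have /all_sig2[b _ yb] i := cid2 (qdom_exists (const_mx (y i) : 'M[T]_1)).
have Xy i : [/\ qherm (X i), qdom (X i) (a i), os_herm (y i) &
              qdom (const_mx (y i) : 'M[T]_1) (b i)] by split.
have pos w : max_precone w -> mform (map_mx (tens_map_mx f g) w) h \is Num.real.
  move=> /max_precone_min w0; apply: ger0_real; move: h; apply/mx_coneE; exact: w0.
set c := \sum_i a i * b i.
have := pos _ (max_precone_herm_sum Xy (lexx c)).
have := pos _ (max_precone_herm_sumN Xy (lexx c)).
rewrite !map_mxD !mformD => r1 r2.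
have {r1 r2} := rpredB r2 r1; rewrite opprD addrACA subrr add0r.
have -> : map_mx (tens_map_mx f g) (- v) =
    map_mx ( *:%R (-1)) (map_mx (tens_map_mx f g) v).
  by apply/matrixP => i j; rewrite !mxE linearN scaleN1r.
rewrite mformZ mulN1r opprK -mulr2n -mulr_natr => r.
have := rpredM r (_ : 2^-1 \is Num.real); rewrite mulfK //; apply.
by rewrite rpredV realn.
Qed.

(** Split the first factors of a representation into their self-adjoint parts. By
    [max_precone_real] the two resulting sums have real forms, and so does [u];
    hence the form of the imaginary sum vanishes, and that sum with it. *)
Lemma min_cone_herm_sum (S T : opsys R) n (u : 'M[tensor S T]_n) : min_cone u ->
  exists N (X : 'I_N -> 'M[S]_n) (y : 'I_N -> T),
    [/\ forall i, qherm (X i), forall i, os_herm (y i) &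
        u = \sum_i tens_mxl (X i) (y i)].
Proof.
move=> u0; have [N [X [y [yh uE]]]] := tensor_mx_sum u.
have /choice[A /choice[B AB]] := fun i => cartesian_decomposition (X i).
pose uA := \sum_i tens_mxl (A i) (y i); pose uB := \sum_i tens_mxl (B i) (y i).
have uAB : u = uA + map_mx ( *:%R 'i) uB.
  rewrite uE; apply/matrixP => k l; rewrite !mxE !summxE scaler_sumr -big_split.
  apply: eq_bigr => i _; have [_ _ ->] := AB i.
  by rewrite !mxE linearDl linearZl_LR.
have Ah i : qherm (A i) by case: (AB i).
have Bh i : qherm (B i) by case: (AB i).
exists N, A, y; split=> //; suff uB0 : uB = 0.
  rewrite uAB uB0 -[RHS]addr0; congr (_ + _).
  by apply/matrixP => k l; rewrite !mxE scaler0.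
apply: tensor_mform_eq0 => k m f g h fP gP.
have rA := max_precone_real h Ah yh fP gP; have rB := max_precone_real h Bh yh fP gP.
have : mform (map_mx (tens_map_mx f g) u) h \is Num.real.
  by apply: ger0_real; move: h {rA rB}; apply/mx_coneE; exact: u0.
have -> : map_mx (tens_map_mx f g) u = map_mx (tens_map_mx f g) uA +
    map_mx ( *:%R 'i) (map_mx (tens_map_mx f g) uB).
  by rewrite uAB; apply/matrixP => i j; rewrite !mxE linearD linearZ.
rewrite mformD mformZ rpredDl // => /CrealP; rewrite rmorphM /= conjCi (CrealP rB).
move=> /eqP; rewrite mulNr eq_sym -addr_eq0 -mulr2n mulrn_eq0 mulf_eq0.
by rewrite (negbTE (neq0Ci C)) => /eqP.
Qed.

End HermitianTensors.

(** * Approximation in an inductive limit *)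

Section InductiveLimit.
Variable R : realType.
Local Notation C := R[i].

(** For fixed [h], the real part of a complex number is no larger than the number
    itself. *)
Lemma qdom_cartesian (L : opsys R) n (X A B : 'M[L]_n) c :
  qherm X -> qherm A -> qherm B ->
  qdom (X - (A + map_mx ( *:%R 'i) B)) c -> qdom (X - A) c.
Proof.
move=> Xr Ar Br Xc h; apply: le_trans (Xc h).
rewrite !(qfD, qfN) qfZ opprD addrA -mulrN.
have r1 : qf X h - qf A h \is Num.real by rewrite rpredB.
have r2 : - qf B h \is Num.real by rewrite rpredN.
rewrite -(@ler_pXn2r _ 2) ?nnegrE // normC2_rect // real_normK // lerDl.
by rewrite real_exprn_even_ge0.
Qed.

Variables (S : nat -> opsys R) (u : forall n, {linear S n -> S n.+1}).
Variables (L : opsys R) (lam : forall n, {linear S n -> L}).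
Hypothesis lam_ucoe : forall n, ucoe (lam n).
Hypothesis lam_compat : forall n x, lam n x = lam n.+1 (u n x).
Hypothesis lam_dense :
  @os_set R L =
    (norm_closure (\bigcup_n range (fun x : S n => os_val (lam n x))))%classic.

Lemma lam_factor n m (x : S n) : (n <= m)%N -> exists y : S m, lam m y = lam n x.
Proof.
elim: m => [|m IH]; rewrite leq_eqVlt => /predU1P[nm|//].
- by subst n; exists x.
- by subst n; exists x.
- by move=> /IH[y <-]; exists (u m y); rewrite -lam_compat.
Qed.

Lemma lam_approx (x : L) (c : C) : 0 < c ->
  exists N, forall m, (N <= m)%N -> exists y : S m,
    forall h, `|os_app (x - lam m y) h| <= c * `|h|.
Proof.
move=> /positive_complex[e e0 ->].
have /asboolP := os_valP x; rewrite lam_dense => -[_ /(_ e e0)[b [N _ [y _ <-]] xb]].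
exists N => m /(lam_factor y)[z zE]; exists z => h.
by rewrite zE; exact: xb.
Qed.

(** Approximate entrywise, and keep the self-adjoint part of the approximation. *)
Lemma lam_approx_herm n (X : 'M[L]_n) (c : C) : qherm X -> 0 < c ->
  exists N, forall m, (N <= m)%N -> exists Y : 'M[S m]_n,
    qherm Y /\ qdom (X - map_mx (lam m) Y) c.
Proof.
move=> Xh c0; have c'0 : 0 < c / n.+1%:R by rewrite divr_gt0 ?ltr0n.
have /choice[N NP] := fun p : 'I_n * 'I_n => lam_approx (X p.1 p.2) c'0.
exists (\max_p N p) => m Nm.
have /choice[y yP] p : exists y : S m,
    forall h, `|os_app (X p.1 p.2 - lam m y) h| <= c / n.+1%:R * `|h|.
  by apply: NP; apply: leq_trans Nm; exact: leq_bigmax.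
pose Y : 'M[S m]_n := \matrix_(i, j) y (i, j).
have [A [B [Ah Bh YE]]] := cartesian_decomposition Y.
exists A; split=> //.
have lucp := ucoe_ucp (lam_ucoe m).
apply: (@qdom_cartesian _ _ _ _ (map_mx (lam m) B)) => //;
  [exact: ucp_qherm|exact: ucp_qherm|].
have -> : map_mx (lam m) A + map_mx ( *:%R 'i) (map_mx (lam m) B) = map_mx (lam m) Y.
  by rewrite YE; apply/matrixP => i j; rewrite !mxE linearD linearZ.
have Yd : qdom (X - map_mx (lam m) Y) (c / n.+1%:R * n%:R).
  apply: qdom_entries => [|i j h]; first exact: ltW.
  by have := yP (i, j) h; rewrite /Y !mxE.
move=> h; apply: le_trans (Yd h) _; rewrite ler_wpM2r ?sqnorm_ge0 //.
by rewrite mulrAC ler_pdivrMr ?ltr0n // ler_wpM2l ?ler_nat // ltW.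
Qed.

End InductiveLimit.

(** * Nuclearity of the inductive limit *)

(** The elementary cone is a maximal cone, hence smaller than the minimal one, over
    a larger operator system; restrict to [S]. *)
Lemma el_cone_min (R : realType) (S : opsys R) (I : injective_envelope S)
    (T : opsys R) n (u : 'M[tensor S T]_n) : el_cone I u -> min_cone u.
Proof. by move=> /max_cone_min/(min_cone_ucoe (ie_emb_ucoe I)). Qed.

Theorem theorem4p4 (R : realType) (S : nat -> opsys R)
    (u : forall n : nat, {linear S n -> S n.+1}) (hu : forall n, ucoe (u n))
    (L : opsys R) (lam : forall n : nat, {linear S n -> L})
    (hL : inductive_limit u lam)
    (IS : forall n : nat, injective_envelope (S n)) (IL : injective_envelope L) :
  (forall n : nat, nuclear (@min_cone R (S n)) (el_cone (IS n))) ->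
  nuclear (@min_cone R L) (el_cone IL).
Proof.
move=> nucS T; split=> [|n v]; first by exists idfun.
rewrite (map_mx_id (f := idfun)) //; split; last exact: el_cone_min.
have [lam_ucoe lam_compat lam_dense _] := hL.
move=> v0; have [N [X [y [Xh yh vE]]]] := min_cone_herm_sum v0.
apply/max_coneP => e e0.
(* The budget [e] is spent in three equal parts [c]: twice to absorb the error
   of approximation, once for the Archimedean closure over [S m]. *)
have /all_sig2[k k0 yk] i := cid2 (qdom_exists (const_mx (y i) : 'M[T]_1)).
pose K := \sum_i k i; have K0 : 0 <= K by apply: sumr_ge0 => i _; exact: ltW.
pose c := e / 3; have c0 : 0 < c by rewrite divr_gt0.
pose d := c / (K + 1); have d0 : 0 < d by rewrite divr_gt0 // ltr_wpDl.
have dK : \sum_i d * k i <= c.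
  rewrite -mulr_sumr -/K /d mulrAC ler_pdivrMr ?ltr_wpDl //.
  by rewrite ler_wpM2l ?lerDl // ltW.
have /choice[M MP] i :=
  lam_approx_herm lam_ucoe lam_compat lam_dense (Xh i) d0.
pose m := \max_i M i.
have /choice[Y YP] i := MP i m (leq_bigmax i).
pose w := \sum_i tens_mxl (Y i) (y i).
pose one1 (V : opsys R) := tens (os_one V) (os_one T).
pose lamT : {linear tensor (S m) T -> tensor L T} := tens_map (lam m) (idfun : T -> T).
have lamTE x z : lamT (tens x z) = tens (lam m x) z by exact: tens_mapE.
pose Z i := X i - map_mx (lam m) (Y i).
have ZP i : [/\ qherm (Z i), qdom (Z i) d, os_herm (y i) &
    qdom (const_mx (y i) : 'M[T]_1) (k i)].
  split=> //; last exact: (YP i).2.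
  move=> h; rewrite qfD qfN rpredB //; first exact: Xh.
  exact: (ucp_qherm (ucoe_ucp (lam_ucoe m)) (YP i).1).
have vw : v - map_mx lamT w = \sum_i tens_mxl (Z i) (y i).
  rewrite vE; apply/matrixP => i j; rewrite !mxE !summxE linear_sum -sumrB.
  by apply: eq_bigr => l _; rewrite !mxE lamTE linearBl.
(* Positivity moves down to the approximant: over [L], [c 1 + w] exceeds [v] by
   an element of the maximal cone, and the minimal cone of [S m] is the
   restriction of that of [L]. *)
have w0 : min_cone (scalar_mxv (one1 (S m)) n c + w).
  apply: (min_cone_ucoe (lam_ucoe m)).
  change (min_cone (map_mx lamT (scalar_mxv (one1 (S m)) n c + w))).
  rewrite map_mxD map_scalar_mxv.
  have -> : lamT (one1 (S m)) = one1 L.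
    by rewrite lamTE; case: (lam_ucoe m) => ->.
  have -> : scalar_mxv (one1 L) n c + map_mx lamT w =
      v + (scalar_mxv (one1 L) n c - (v - map_mx lamT w)).
    by rewrite opprB addrCA [v + _]addrCA subrr addr0.
  apply: (min_coneD v0); rewrite vw; apply: max_precone_min.
  exact: max_precone_herm_sumN ZP dK.
have /((nucS m T).2 n) := w0; rewrite (map_mx_id (f := idfun)) //.
move=> /max_coneP/(_ c c0) wmax.
(* Injectivity of the envelope of [L] carries the maximal cone from the envelope
   of [S m] to that of [L]. *)
have iL := ucoe_ucp (ie_emb_ucoe IL).
have [phi [phi1 phiP] phiE] := @ie_injective _ _ IL _ _ _ _ (ie_emb_ucoe (IS m))
  (ucp_comp (ucoe_ucp (lam_ucoe m)) iL).
have := max_preconeD (max_precone_cp phiP wmax)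
  (max_precone_cp iL.2 (max_precone_herm_sum ZP dK)).
rewrite -vw; congr max_precone.
have phiT z : tens_map phi (idfun : T -> T)
      (tens_map (ie_emb (IS m)) (idfun : T -> T) z) =
    tens_map (ie_emb IL) (idfun : T -> T) (lamT z).
  have [s ->] := tensP z; rewrite !linear_sum; apply: eq_bigr => p _.
  by rewrite lamTE /= !tens_mapE phiE.
have -> : e = c + c + c by rewrite /c; field.
rewrite !map_mxD map_mxN !map_scalar_mxv /= !tens_mapE phiE phi1 /=.
rewrite (ucoe_ucp (lam_ucoe m)).1 iL.1 !scalar_mxvD.
rewrite -!map_mx_comp (eq_map_mx _ phiT) /=.
have sum3 (V : zmodType) (s a b : V) : s + a + s + (s + (b - a)) = b + (s + s + s).
  by rewrite addrA addrC [s + a]addrC -!(addrA a) addrA subrK.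
exact: sum3.
Qed.
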